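(* Let $K$ be a symmetric polytope of volume $1$ in $\mathbb{R}^n$. Then $$\lim_{p\rightarrow\infty} \frac{p}{\log p}\left( |Z_{p}^{\circ}(K)| - |K^{\circ}|\right) = n^{2}\, |K^{\circ}| .$$
   Context: $\mathbb{R}^n$ carries its Euclidean inner product $\langle\cdot,\cdot\rangle$; $S^{n-1}$ is the unit sphere and $|\cdot|$ denotes volume ($n$-dimensional Lebesgue measure). A convex body is a compact convex set with non-empty interior; a polytope in $\mathbb{R}^n$ is a convex body that is the convex hull of finitely many points. A convex body $C$ is symmetric if $x\in C$ implies $-x\in C$. The support function of $C$ is $h_C(x)=\max\{\langle x,y\rangle : y\in C\}$ and its polar body is $C^{\circ}=\{y\in\mathbb{R}^n : \langle x,y\rangle\le 1 \text{ for all } x\in C\}$. For a symmetric convex body $K$ of volume $1$ in $\mathbb{R}^n$ and $1\le p<\infty$, the $L_p$-centroid body $Z_p(K)$ is the convex body with support function $$h_{Z_p(K)}(\theta)=\left(\int_K |\langle x,\theta\rangle|^p\,dx\right)^{1/p},\qquad \theta\in S^{n-1},$$ and $Z_p^{\circ}(K)$ denotes the polar body $(Z_p(K))^{\circ}$. *)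

(* Defs.v *)
From HB Require Import structures.
From mathcomp Require Import all_boot all_order all_algebra.
From mathcomp Require Import all_classical all_reals all_analysis.

Set Implicit Arguments.
Unset Strict Implicit.
Unset Printing Implicit Defensive.

Import Order.TTheory GRing.Theory Num.Theory.
Import numFieldNormedType.Exports.

Local Open Scope classical_set_scope.
Local Open Scope ring_scope.

(** * Lebesgue measure on row vectors *)

Definition measure_rV_display : measure_display -> measure_display.
Proof. exact. Qed.

Section measurable_rV.
Context {d} {T : measurableType d}.
Variable n : nat.

Let coors : 'I_n -> 'rV[T]_n -> T := fun i x => x ord0 i.

Let rV_set0 : g_sigma_preimage coors set0.
Proof. exact: sigma_algebra0. Qed.

Let rV_setC A : g_sigma_preimage coors A -> g_sigma_preimage coors (~` A).
Proof. exact: sigma_algebraC. Qed.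

Let rV_bigcup (F : _^nat) : (forall i, g_sigma_preimage coors (F i)) ->
  g_sigma_preimage coors (\bigcup_i (F i)).
Proof. exact: sigma_algebra_bigcup. Qed.

(* The product sigma-algebra, generated by the coordinate maps, exactly as the
   library does for [n.-tuple T]; for [T := R] these are the Borel sets. *)
HB.instance Definition _ := @isMeasurable.Build (measure_rV_display d)
  'rV[T]_n (g_sigma_preimage coors) rV_set0 rV_setC rV_bigcup.

End measurable_rV.

Lemma measurable_coord d (T : measurableType d) n (i : 'I_n) :
  measurable_fun [set: 'rV[T]_n] (fun x : 'rV[T]_n => x ord0 i).
Proof.
move=> _ Y mY; rewrite setTI; apply: sub_sigma_algebra => /=.
rewrite -bigcup_seq/=; exists i => /=; first by rewrite mem_index_enum.
by exists Y => //; rewrite setTI.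
Qed.

Lemma measurable_fun_rVP d1 d2 (T1 : measurableType d1) (T2 : measurableType d2)
    n (f : T1 -> 'rV[T2]_n) :
  measurable_fun [set: T1] f <->
  forall i, measurable_fun [set: T1] (fun x => f x ord0 i).
Proof.
split=> [mf i|mf _ Y mY].
  exact: (measurableT_comp (@measurable_coord _ T2 n i) mf).
rewrite setTI.
suff : measurable `<=` [set A : set 'rV[T2]_n | measurable (f @^-1` A)].
  by apply.
apply: smallest_sub.
  split=> [|A /= mA|F mF] /=.
  - by rewrite preimage_set0.
  - by rewrite setTD preimage_setC; exact: measurableC.
  - by rewrite preimage_bigcup; exact: bigcupT_measurable.
rewrite -bigcup_seq => A [i _ [B mB <-]] /=.
by rewrite setTI; have := mf i measurableT B mB; rewrite setTI.
Qed.

(* (x, v) |-> (x, v_0, ..., v_{n-1}); note that [1 + n] is [n.+1]. *)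
Definition rV_cons {T : Type} n (xv : T * 'rV[T]_n) : 'rV[T]_n.+1 :=
  row_mx (const_mx xv.1 : 'rV_1) xv.2.

Lemma measurable_rV_cons (R : realType) n :
  measurable_fun [set: measurableTypeR R * 'rV[R]_n] (@rV_cons R n).
Proof.
apply/measurable_fun_rVP => i; case: (@split_ordP 1 n i) => j ->.
  rewrite [X in measurable_fun _ X](_ : _ = fst); first exact: measurable_fst.
  by apply/funext => xv; rewrite [LHS]row_mxEl mxE.
rewrite [X in measurable_fun _ X](_ : _ =
    fun xv : measurableTypeR R * 'rV[R]_n => xv.2 ord0 j).
  exact: (measurableT_comp (@measurable_coord _ R n j) measurable_snd).
by apply/funext => xv; rewrite [LHS]row_mxEr.
Qed.

Lemma rV_cons_inv (R : realType) n :
  exists u : 'rV[R]_n.+1 -> measurableTypeR R * 'rV[R]_n,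
  [/\ measurable_fun setT u, cancel (@rV_cons R n) u & cancel u (@rV_cons R n)].
Proof.
exists (fun v : 'rV[R]_n.+1 => (v ord0 ord0, rsubmx (v : 'rV_(1 + n)))); split.
- apply/measurable_fun_pairP; split; first exact: measurable_coord.
  apply/measurable_fun_rVP => i.
  rewrite [X in measurable_fun _ X](_ : _ =
    fun v : 'rV[R]_(1 + n) => v ord0 (rshift 1 i)).
    exact: measurable_coord.
  by apply/funext => v; rewrite /= mxE.
- case=> x v; rewrite /rV_cons/= row_mxKr; congr pair.
  transitivity (row_mx (const_mx x : 'rV_1) v ord0 (lshift n ord0)).
    by congr (row_mx _ _ _ _); exact: val_inj.
  by rewrite row_mxEl mxE.
- move=> v; apply/rowP => i; case: (@split_ordP 1 n i) => j ->.
    rewrite [LHS]row_mxEl mxE/=; congr (fun_of_matrix v _ _).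
    by rewrite ord1; exact: val_inj.
  by rewrite [LHS]row_mxEr mxE.
Qed.

(* [lebesgue_rV n.+1] is the product of [lebesgue_measure] and [lebesgue_rV n],
   transported along [rV_cons]; [lebesgue_rV 0] is the unit mass on the point
   of ['rV_0]. *)
Fixpoint lebesgue_rV {R : realType} n : set 'rV[R]_n -> \bar R :=
  match n with
  | 0 => dirac (0 : 'rV[R]_0)
  | m.+1 =>
    pushforward (product_measure1 (@lebesgue_measure R) (@lebesgue_rV R m))
      (@rV_cons R m)
  end.
Arguments lebesgue_rV {R} n _.

Lemma ex_sigma_finite_measure d (T : measurableType d) (R : realType)
    (p : set T -> \bar R) :
  p set0 = 0%E -> (forall A, 0 <= p A)%E -> semi_sigma_additive p ->
  sigma_finite setT p ->
  exists mu : {sigma_finite_measure set T -> \bar R},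
    p = mu :> (set T -> \bar R).
Proof.
move=> p0 pge0 psig pfin.
pose H1 := isMeasure.Build _ _ _ p p0 pge0 psig.
pose p1 : {measure set T -> \bar R} := HB.pack p H1.
pose H2 := Measure_isSigmaFinite.Build _ _ _ p1 pfin.
pose p2 : {sigma_finite_measure set T -> \bar R} := HB.pack p H1 H2.
by exists p2.
Qed.

(* Restates the library's instance, which canonical structure inference does
   not find when the factors are not probability measures. *)
Lemma sigma_finite_product_measure1 d1 d2
    (T1 : measurableType d1) (T2 : measurableType d2) (R : realType)
    (m1 : {sigma_finite_measure set T1 -> \bar R})
    (m2 : {sigma_finite_measure set T2 -> \bar R}) :
  sigma_finite setT (product_measure1 m1 m2).
Proof.
have /sigma_finiteP[F [TF ndF Foo]] := sigma_finiteT m1.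
have /sigma_finiteP[G [TG ndG Goo]] := sigma_finiteT m2.
exists (fun n => F n `*` G n).
  rewrite -setXTT TF TG predeqE => -[x y]; split.
    move=> [/= [n _ Fnx] [k _ Gky]]; exists (maxn n k) => //; split.
    - by move: x Fnx; exact/subsetPset/ndF/leq_maxl.
    - by move: y Gky; exact/subsetPset/ndG/leq_maxr.
  by move=> [n _ []/= ? ?]; split; exists n.
move=> k; have [? ?] := Foo k; have [? ?] := Goo k.
split; first exact: measurableX.
by rewrite product_measure1E// lte_mul_pinfty// ge0_fin_numE.
Qed.

Lemma pushforward_rV_cons_measure (R : realType) n
    (m : {measure set (measurableTypeR R * 'rV[R]_n)%type -> \bar R}) :
  sigma_finite setT m ->
  exists mu : {sigma_finite_measure set 'rV[R]_n.+1 -> \bar R},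
    pushforward m (@rV_cons R n) = mu :> (set 'rV[R]_n.+1 -> \bar R).
Proof.
move=> [F FT Foo]; have [u [mu uK Ku]] := rV_cons_inv R n.
have mcons A : measurable A -> measurable (@rV_cons R n @^-1` A).
  by move=> mA; rewrite -[X in measurable X]setTI; exact: measurable_rV_cons.
apply: ex_sigma_finite_measure; rewrite /pushforward.
- by rewrite preimage_set0 measure0.
- by move=> A; rewrite measure_ge0.
- move=> G mG tG mUG; rewrite preimage_bigcup.
  apply: measure_semi_sigma_additive.
  + by move=> k; exact: mcons.
  + apply/trivIsetP => /= i j _ _ ij; rewrite -preimage_setI.
    by move/trivIsetP : tG => /(_ _ _ _ _ ij) ->//; rewrite preimage_set0.
  + by rewrite -preimage_bigcup; exact: mcons.
- exists (fun k => u @^-1` F k).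
    by rewrite -preimage_bigcup -FT preimage_setT.
  move=> k; have [mFk Fkoo] := Foo k; split.
    by rewrite -[X in measurable X]setTI; exact: mu.
  rewrite (_ : _ @^-1` _ = F k)//.
  by apply/seteqP; split=> x /=; rewrite uK.
Qed.

Lemma lebesgue_rV_is_measure (R : realType) n :
  exists mu : {sigma_finite_measure set 'rV[R]_n -> \bar R},
    lebesgue_rV n = mu :> (set 'rV[R]_n -> \bar R).
Proof.
elim: n => [|n [mu IH]] /=; first by exists (dirac (0 : 'rV[R]_0)).
rewrite IH; apply: pushforward_rV_cons_measure.
exact: sigma_finite_product_measure1.
Qed.

Section lebesgue_rV_measure.
Context {R : realType} (n : nat).
Local Notation mu := (@lebesgue_rV R n).

Let lebesgue_rV0 : mu set0 = 0%E.
Proof. by have [m ->] := lebesgue_rV_is_measure R n; exact: measure0. Qed.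

Let lebesgue_rV_ge0 A : (0 <= mu A)%E.
Proof. by have [m ->] := lebesgue_rV_is_measure R n; exact: measure_ge0. Qed.

Let lebesgue_rV_sigma_additive : semi_sigma_additive mu.
Proof.
have [m ->] := lebesgue_rV_is_measure R n.
exact: measure_semi_sigma_additive.
Qed.

HB.instance Definition _ := isMeasure.Build _ _ _ mu
  lebesgue_rV0 lebesgue_rV_ge0 lebesgue_rV_sigma_additive.

Let lebesgue_rV_sigma_finite : sigma_finite setT mu.
Proof. by have [m ->] := lebesgue_rV_is_measure R n; exact: sigma_finiteT. Qed.

HB.instance Definition _ :=
  Measure_isSigmaFinite.Build _ _ _ mu lebesgue_rV_sigma_finite.

End lebesgue_rV_measure.

(** * Convex bodies *)

Section convex_bodies.
Context {R : realType} {n : nat}.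
Local Notation E := 'rV[R]_n.
Implicit Types (x y : E) (C K V Z : set E).

Definition dotp x y : R := \sum_i x ord0 i * y ord0 i.

(* The norm of the normed module ['rV_n] is the sup norm, so that the Euclidean
   unit sphere has to be written with [dotp]. The topologies coincide. *)
Definition unit_sphere : set E := [set x | Num.sqrt (dotp x x) = 1].

Definition volume C : R := fine (lebesgue_rV n C).

Definition convex_body C :=
  [/\ compact C, convex_set (C : set (convex_lmodType E)) & interior C !=set0].

Definition conv_hull V : set E :=
  smallest (@convex_set R E) (V : set (convex_lmodType E)).

Definition polytope C :=
  convex_body C /\ exists2 V, finite_set V & C = conv_hull V.

Definition symmetric_set C := forall x, C x -> C (- x).

(* A maximum when [C] is compact and nonempty. *)
Definition support_fun C x : R := sup [set dotp x y | y in C].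

Definition polar C : set E := [set y | forall x, C x -> dotp x y <= 1].

Definition is_Lp_centroid_body (p : R) K Z :=
  convex_body Z /\ forall theta, unit_sphere theta ->
    support_fun Z theta =
    (\int[lebesgue_rV n]_(x in K) (`|dotp x theta| `^ p)) `^ p^-1.

(* Definite description: a convex body is determined by its support function on
   the unit sphere, and the right-hand side above is indeed the support function
   of a convex body when [K] is a symmetric convex body of volume 1 and
   [1 <= p]; otherwise the value may be the dummy [set0]. *)
Definition Lp_centroid_body (p : R) K : set E :=
  xget set0 (is_Lp_centroid_body p K).

End convex_bodies.

(* Main.v *)
Require Import Defs.
From mathcomp Require Import all_boot all_order all_algebra.
From mathcomp Require Import all_classical all_reals all_analysis.
From mathcomp Require Import measurable_realfun ring lra.

Import Order.TTheory GRing.Theory Num.Theory.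
Import numFieldNormedType.Exports.

Local Open Scope classical_set_scope.
Local Open Scope ring_scope.

(** Write [I_p(y)] for the integral of [|<x,y>|^p] over [K], called
    [moment K p y] below, and [W_p] for [{y | I_p(y) <= 1}], the polar of the
    centroid body. Comparing sets with dilates of each other replaces polar
    coordinates.

    If [v] maximizes [<.,y>] over [K], then [(1-s)v + sK] is a subset of [K] of
    volume [s^n] on which [<.,y> >= (1-2s) <v,y>]. For [s = 1/p] this bounds
    [I_p(y)] from below and gives [W_p <= l K°] for [l = exp((4 + n ln p)/p)],
    where [l^n - 1] is equivalent to [n^2 ln p / p].

    Conversely, let a vertex [v] beat all the others at [y] in [K°] by a
    relative gap [d]. Then [<x,y> <= <v,y> (1 - c |x - v|)] on [K], with [c]
    independent of [y], so that [I_p(y) <= p^(e-n)] for [p] large. Hence [W_p]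
    contains the dilate by [p^((n-e)/p)] of the set [A] of these [y]. This dilate
    is disjoint from [K° \ A], which is also contained in [W_p], because having
    gap [d] is invariant under dilations. As [d] tends to 0, [A] exhausts [K°] up
    to finitely many hyperplanes. *)

(** * Lebesgue measure on row vectors *)

(** Uniqueness of Lebesgue measure: the pushforward scaled by [s] gives every []u, v]] its
    length. *)
Lemma lebesgue_measure_affine (R : realType) (s a : R) (A : set R) :
  0 < s -> measurable A ->
  (s%:E * lebesgue_measure ((fun x => a + s * x)%R @^-1` A))%E =
  lebesgue_measure A.
Proof.
move=> s0 mA.
pose f (x : measurableTypeR R) : measurableTypeR R := a + s * x.
have mf : measurable_fun setT f.
  by apply: measurable_funD => //; apply: measurable_funM.
pose m' := mscale (NngNum (ltW s0)) (pushforward lebesgue_measure f).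
transitivity (m' mf A) => //.
apply/esym/lebesgue_measure_unique => // _ [[u v]] _ <-.
rewrite /m' /= /mscale /= /pushforward /=.
have -> : f @^-1` `]u, v]%classic = `](u - a) / s, (v - a) / s]%classic.
  apply/seteqP; split => x /=; rewrite !in_itv/= /f.
    by rewrite ltr_pdivrMr// ler_pdivlMr// mulrC; lra.
  by rewrite ltr_pdivrMr// ler_pdivlMr// mulrC; lra.
rewrite !lebesgue_measure_itv/= !lte_fin.
rewrite ltr_pM2r ?invr_gt0// ltrD2r.
case: ifPn => uv; last by rewrite mule0.
rewrite -!EFinD -EFinM; congr EFin; field; exact: lt0r_neq0.
Qed.

Lemma rV_consE (T : Type) n (xv : T * 'rV[T]_n) i :
  rV_cons xv ord0 (lift ord0 i) = xv.2 ord0 i.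
Proof.
rewrite /rV_cons (_ : lift ord0 i = rshift 1 i); last exact: val_inj.
by rewrite [LHS]row_mxEr.
Qed.

Lemma rV_consE0 (T : Type) n (xv : T * 'rV[T]_n) :
  rV_cons xv ord0 ord0 = xv.1.
Proof.
transitivity (row_mx (const_mx xv.1 : 'rV_1) xv.2 ord0 (lshift n ord0)).
  by congr (row_mx _ _ _ _); exact: val_inj.
by rewrite [LHS]row_mxEl mxE.
Qed.

Lemma measurable_affine_rV (R : realType) n (a : 'rV[R]_n) (s : R) :
  measurable_fun setT (fun x : 'rV[R]_n => a + s *: x).
Proof.
apply/measurable_fun_rVP => i.
under eq_fun do rewrite !mxE.
apply: measurable_funD => //; apply: measurable_funM => //.
exact: measurable_coord.
Qed.

(** Induction on the dimension: [rV_cons] conjugates the map to a product of affine maps, and a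
    measure with the right values on rectangles is the product measure. *)
Lemma lebesgue_rV_affine (R : realType) n (s : R) (a : 'rV[R]_n) A :
  0 < s -> measurable A ->
  ((s ^+ n)%:E * lebesgue_rV n ((fun x => a + s *: x)%R @^-1` A))%E =
  lebesgue_rV n A.
Proof.
move=> s0; elim: n a A => [|n IH] a A mA.
  rewrite expr0 mul1e /= !diracE; congr (_%:R%:E); congr nat_of_bool.
  by apply/idP/idP; rewrite !inE/= (thinmx0 a) scaler0 addr0.
pose f (xv : measurableTypeR R * 'rV[R]_n) : measurableTypeR R * 'rV[R]_n :=
  (a ord0 ord0 + s * xv.1, (\row_i a ord0 (lift ord0 i)) + s *: xv.2).
have mf : measurable_fun setT f.
  apply/measurable_fun_pairP; split.
    by apply: measurable_funD => //; apply: measurable_funM.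
  exact: (measurableT_comp (measurable_affine_rV _ _ _ _) measurable_snd).
have s1 : 0 <= s ^+ n.+1 by apply: exprn_ge0; exact: ltW.
pose m' := mscale (NngNum s1)
  (pushforward (product_measure1 lebesgue_measure (lebesgue_rV n)) f).
have mA' : measurable (@rV_cons R n @^-1` A).
  by rewrite -[X in measurable X]setTI; exact: measurable_rV_cons.
have fE : (fun x : 'rV[R]_n.+1 => a + s *: x) \o @rV_cons R n =
    @rV_cons R n \o f.
  apply/funext => xv /=; apply/rowP => i.
  case: (unliftP ord0 i) => [j|] ->; first by
    rewrite rV_consE [LHS]mxE [X in _ + X]mxE rV_consE/= !mxE.
  by rewrite rV_consE0 [LHS]mxE [X in _ + X]mxE rV_consE0.
transitivity (m' mf (@rV_cons R n @^-1` A)).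
  rewrite /= /m' /mscale /=; congr (_ * _)%E.
  by rewrite /pushforward/= -[in LHS]comp_preimage fE.
apply/esym.
apply: (@product_measure_unique _ _ _ _ R lebesgue_measure
  (lebesgue_rV n) (m' mf)) => // B C mB mC.
rewrite /m' /= /mscale /= /pushforward /=.
have -> : f @^-1` (B `*` C) = ((fun x => a ord0 ord0 + s * x) @^-1` B) `*`
  ((fun x => (\row_i a ord0 (lift ord0 i)) + s *: x) @^-1` C) by [].
rewrite product_measure1E.
- by rewrite exprS EFinM muleACA lebesgue_measure_affine// IH.
- rewrite -[X in measurable X]setTI.
  have : measurable_fun setT (fun x : R => a ord0 ord0 + s * x).
    by apply: measurable_funD => //; apply: measurable_funM.
  exact.
- rewrite -[X in measurable X]setTI; exact: measurable_affine_rV.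
Qed.

Lemma coord_le_norm (R : realType) n (x : 'rV[R]_n) i : `|x ord0 i| <= `|x|.
Proof.
rewrite [leRHS]mx_normrE.
exact: (le_bigmax _ (fun ij : 'I_1 * 'I_n => `|x ij.1 ij.2|) (ord0, i)).
Qed.

Lemma norm_le_coord (R : realType) n (x : 'rV[R]_n) r :
  0 <= r -> (forall i, `|x ord0 i| <= r) -> `|x| <= r.
Proof.
move=> r0 xr; rewrite [leLHS]mx_normrE; apply/bigmax_leP; split => // -[i j] _.
by rewrite (ord1 i).
Qed.

Lemma norm_leP (R : realType) n (x : 'rV[R]_n) r :
  0 <= r -> `|x| <= r <-> (forall i, `|x ord0 i| <= r).
Proof.
move=> r0; split => [xr i|]; last exact: norm_le_coord.
exact: le_trans (coord_le_norm _ _ _ _) xr.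
Qed.

Lemma measurable_coord_itv (R : realType) n i (J : interval R) :
  measurable [set x : 'rV[R]_n | x ord0 i \in J].
Proof.
have := @measurable_coord _ (measurableTypeR R) n i measurableT [set` J].
by rewrite setTI; apply; exact: measurable_itv.
Qed.

(** Links the topology to the sigma-algebra generated by the coordinates: an open set is the union
    of the countably many boxes with rational centre and half-width [1/(k+1)] that it contains. *)
Lemma open_measurable_rV (R : realType) n (U : set 'rV[R]_n) :
  open U -> measurable U.
Proof.
move=> oU.
pose box (qk : 'rV[rat]_n * nat) : set 'rV[R]_n := \bigcap_(i in [set: 'I_n])
  [set x | x ord0 i \in `](ratr (qk.1 ord0 i) - qk.2.+1%:R^-1)%R,
                           (ratr (qk.1 ord0 i) + qk.2.+1%:R^-1)%R[].
have -> : U = \bigcup_qk (if `[< box qk `<=` U >] then box qk else set0).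
  apply/seteqP; split => [x Ux|x [qk _]]; last first.
    by case: asboolP => // sU bx; exact: sU.
  move: oU => /(_ _ Ux)/nbhs_ballP[e /= e0 eU].
  near \oo => k.
  have ke : k.+1%:R^-1 < e / 2.
    near: k; apply: (near_infty_natSinv_lt (PosNum _)).
    by rewrite divr_gt0.
  have := ke; have k0 : 0 < k.+1%:R^-1 :> R by rewrite invr_gt0.
  move: k0; set d := (k.+1%:R^-1 : R) => k0 de.
  have /all_sig[q qx] i : {q : rat |
      ratr q \in `](x ord0 i - d), (x ord0 i + d)[%R}.
    apply: cid; apply: rat_in_itvoo.
    by rewrite ltrD2l (lt_trans _ k0)// oppr_lt0.
  exists (\row_i q i, k) => //; case: asboolP => [_|].
    move=> i _ /=; rewrite mxE -/d; have := qx i; rewrite !in_itv/=; lra.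
  move=> nU; exfalso; apply: nU => y yq; apply: eU; rewrite mx_norm_ball /ball_ /=.
  apply: (@le_lt_trans _ _ (2 * d)); last by lra.
  apply: norm_le_coord; first by lra.
  move=> i; have := yq i I; have := qx i; rewrite /= !mxE -/d !in_itv/= => ? ?.
  rewrite ler_norml; lra.
apply: countable_bigcupT_measurable; first exact: countableP.
move=> qk; case: asboolP => // _; apply: fin_bigcap_measurable => // i _.
exact: measurable_coord_itv.
Unshelve. all: by end_near.
Qed.

Lemma closed_measurable_rV (R : realType) n (C : set 'rV[R]_n) :
  closed C -> measurable C.
Proof.
move=> cC; rewrite -(setCK C); apply: measurableC; apply: open_measurable_rV.
exact: closed_openC.
Qed.

Lemma measurable_cube (R : realType) n (v : 'rV[R]_n) r : 0 <= r ->
  measurable [set x | `|x - v| <= r].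
Proof.
move=> r0; have -> : [set x | `|x - v| <= r] = \bigcap_(i in [set: 'I_n])
    [set x : 'rV[R]_n | x ord0 i \in `[v ord0 i - r, v ord0 i + r]].
  apply/seteqP; split => x /=.
    move=> /norm_leP => /(_ r0) xr i _ /=; have := xr i.
    by rewrite !mxE in_itv/= ler_norml; lra.
  move=> xr; apply/norm_leP => // i; have := xr i I.
  by rewrite /= !mxE in_itv/= ler_norml; lra.
apply: fin_bigcap_measurable => // i _; exact: measurable_coord_itv.
Qed.

Lemma lebesgue_rV_cube (R : realType) n (r : R) : 0 <= r ->
  lebesgue_rV n [set x : 'rV[R]_n | `|x| <= r] = ((r *+ 2) ^+ n)%:E.
Proof.
move=> r0; elim: n => [|n IH].
  rewrite /= diracE mem_set//= normr0//.
rewrite /= /pushforward.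
have -> : @rV_cons R n @^-1` [set x | `|x| <= r] =
    `[-r, r]%classic `*` [set x | `|x| <= r].
  apply/seteqP; split => -[x v] /=.
    move/norm_leP => /(_ r0) xr; split.
      by have := xr ord0; rewrite rV_consE0/= in_itv/= ler_norml.
    apply/norm_leP => // i.
    by have := xr (lift ord0 i); rewrite rV_consE.
  rewrite in_itv/= -ler_norml => -[xr /norm_leP vr]; apply/norm_leP => // i.
  case: (unliftP ord0 i) => [j|] ->; last by rewrite rV_consE0.
  by rewrite rV_consE; exact: vr.
have lr : lebesgue_measure `[- r, r]%classic = (r *+ 2)%:E.
  rewrite lebesgue_measure_itv/= lte_fin; case: ltP => rr.
    by rewrite -EFinD; congr EFin; rewrite mulr2n opprK.
  have -> : r = 0 by lra.
  by rewrite mul0rn.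
rewrite product_measure1E.
- rewrite exprS EFinM; congr (_ * _)%E; [exact lr|exact IH].
- exact: measurable_itv.
- have := @measurable_cube R n 0 r r0; by under eq_set do rewrite subr0.
Qed.

Lemma lebesgue_rV_cubeC (R : realType) n (v : 'rV[R]_n) (r : R) : 0 <= r ->
  lebesgue_rV n [set x : 'rV[R]_n | `|x - v| <= r] = ((r *+ 2) ^+ n)%:E.
Proof.
move=> r0; rewrite -lebesgue_rV_cube// -[RHS](@lebesgue_rV_affine R n 1 (- v))//.
  rewrite expr1n mul1e; congr (lebesgue_rV n _); apply/seteqP.
  by split => x /=; rewrite scale1r addrC.
have := @measurable_cube R n 0 r r0; by under eq_set do rewrite subr0.
Qed.

Lemma lebesgue_rV_preimage_affine (R : realType) n (s : R) (a : 'rV[R]_n) A :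
  0 < s -> measurable A ->
  lebesgue_rV n ((fun x => a + s *: x) @^-1` A) =
  ((s^-1 ^+ n)%:E * lebesgue_rV n A)%E.
Proof.
move=> s0 mA; rewrite -(@lebesgue_rV_affine R n s a A s0 mA).
rewrite muleA -EFinM -exprMn mulVf ?lt0r_neq0// expr1n mul1e//.
Qed.

(** * Euclidean inner product, polars and null hyperplanes *)

Section dotp.
Context {R : realType} {n : nat}.
Implicit Types (x y z : 'rV[R]_n) (a : R).

Lemma dotpC x y : dotp x y = dotp y x.
Proof. by apply: eq_bigr => i _; rewrite mulrC. Qed.

Lemma dotpDl x y z : dotp (x + y) z = dotp x z + dotp y z.
Proof. by rewrite -big_split; apply: eq_bigr => i _; rewrite mxE mulrDl. Qed.

Lemma dotpZl a x y : dotp (a *: x) y = a * dotp x y.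
Proof. by rewrite mulr_sumr; apply: eq_bigr => i _; rewrite mxE mulrA. Qed.

Lemma dotpNl x y : dotp (- x) y = - dotp x y.
Proof. by rewrite -scaleN1r dotpZl mulN1r. Qed.

Lemma dotpBl x y z : dotp (x - y) z = dotp x z - dotp y z.
Proof. by rewrite dotpDl dotpNl. Qed.

Lemma dotp0l x : dotp 0 x = 0.
Proof. by rewrite -(scale0r 0) dotpZl mul0r. Qed.

Lemma dotpDr x y z : dotp z (x + y) = dotp z x + dotp z y.
Proof. by rewrite ![dotp z _]dotpC dotpDl. Qed.

Lemma dotpZr a x y : dotp x (a *: y) = a * dotp x y.
Proof. by rewrite dotpC dotpZl dotpC. Qed.

Lemma dotpNr x y : dotp x (- y) = - dotp x y.
Proof. by rewrite dotpC dotpNl dotpC. Qed.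

Lemma dotp0r x : dotp x 0 = 0.
Proof. by rewrite dotpC dotp0l. Qed.

Lemma dotp_delta x i : dotp x (delta_mx ord0 i) = x ord0 i.
Proof.
rewrite /dotp (bigD1 i)//= mxE !eqxx mulr1 big1 ?addr0// => j ji.
by rewrite mxE (negbTE ji) andbF mulr0.
Qed.

Lemma dotp_norm_le x y : `|dotp x y| <= n%:R * (`|x| * `|y|).
Proof.
apply: (le_trans (ler_norm_sum _ _ _)).
have -> : n%:R * (`|x| * `|y|) = \sum_(i < n) `|x| * `|y|.
  by rewrite sumr_const card_ord mulr_natl.
apply: ler_sum => i _.
by rewrite normrM ler_pM// coord_le_norm.
Qed.

Lemma dotp_ge0 x : 0 <= dotp x x.
Proof. by apply: sumr_ge0 => i _; rewrite -expr2 sqr_ge0. Qed.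

Lemma dotp_eq0 x : dotp x x = 0 -> x = 0.
Proof.
move=> /psumr_eq0P x0; apply/rowP => i; rewrite mxE; apply/eqP.
by rewrite -sqrf_eq0 expr2 x0// => j _; rewrite -expr2 sqr_ge0.
Qed.

Lemma dotp_continuous y : continuous (fun x => dotp x y).
Proof.
rewrite /dotp; elim: (index_enum _) => [|i s IH].
  by under eq_fun do rewrite big_nil; move=> x; exact: cst_continuous.
under eq_fun do rewrite big_cons.
move=> x; apply: (@continuousD R R^o 'rV[R]_n); last exact: IH.
apply: (@continuousM R 'rV[R]_n); last exact: cst_continuous.
exact: coord_continuous.
Qed.

Lemma measurable_dotp y : measurable_fun setT (fun x : 'rV[R]_n => dotp x y).
Proof.
apply: measurable_sum => i; apply: measurable_funM => //.
exact: measurable_coord.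
Qed.

Lemma polar_closed (C : set 'rV[R]_n) : closed (polar C).
Proof.
rewrite (_ : polar C = \bigcap_(x in C) [set y | dotp x y <= 1]).
  apply: closed_bigI => x _.
  under eq_set do rewrite dotpC.
  apply: (@preimage_closed _ _ (fun y => dotp y x) [set y | y <= 1]).
    move=> z _; exact: dotp_continuous.
  exact: closed_le.
by apply/seteqP; split => y /= yC x; apply: yC.
Qed.

(** If [u] has nonzero [j]-th coordinate, the translates of the set by [1/(k+1)] times the [j]-th
    basis vector are pairwise disjoint, since [dotp _ u] takes a different value on each. They have
    equal measure and all lie in a cube of radius [r + 1], so [N] times that measure stays bounded
    in [N]. *)
Lemma hyperplane_cube_null (u : 'rV[R]_n) (r : R) : u != 0 -> 0 <= r ->
  lebesgue_rV n ([set x | dotp x u = 0] `&` [set x | `|x| <= r]) = 0%E.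
Proof.
move=> u0 r0; set H := _ `&` _.
have mH : measurable H.
  apply: measurableI.
    have := measurable_dotp u measurableT [set 0].
    by rewrite setTI; apply; exact: measurable_set1.
  by have := @measurable_cube R n 0 r r0; under eq_set do rewrite subr0.
have [j uj] : exists j, u ord0 j != 0.
  apply/existsP; apply: contraNT u0; rewrite negb_exists => /forallP u0.
  by apply/eqP/rowP => i; rewrite mxE; apply/eqP; have := u0 i; rewrite negbK.
pose a k : 'rV[R]_n := - (k.+1%:R^-1 *: delta_mx ord0 j).
pose F k := (fun x => a k + 1 *: x) @^-1` H.
have mF k : measurable (F k).
  by rewrite -[X in measurable X]setTI; exact: measurable_affine_rV.
have tF : trivIset setT F.
  apply/trivIsetP => k l _ _ kl; apply/seteqP; split => // x [[+ _] [+ _]] /=.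
  rewrite /mkset /a scale1r !dotpDl !dotpNl !dotpZl ![dotp (delta_mx _ _) _]dotpC.
  rewrite !dotp_delta => e1 e2.
  have /(mulIf uj)/invr_inj/eqP : k.+1%:R^-1 * u ord0 j = l.+1%:R^-1 * u ord0 j.
    by apply/oppr_inj/(addIr (dotp x u)); rewrite e1 e2.
  by rewrite eqr_nat eqSS (negbTE kl).
have FH k : lebesgue_rV n (F k) = lebesgue_rV n H.
  by rewrite lebesgue_rV_preimage_affine// invr1 expr1n mul1e.
have HV : (lebesgue_rV n H <= (((r + 1) *+ 2) ^+ n)%:E)%E.
  rewrite -lebesgue_rV_cube; last by lra.
  have := @measurable_cube R n 0 (r + 1); under eq_set do rewrite subr0.
  move=> mc; apply: le_measure; rewrite ?inE//; first by apply: mc; lra.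
  move=> x [_ /=]; lra.
have Fsub N : \big[setU/set0]_(k < N) F k `<=` [set x | `|x| <= r + 1].
  rewrite -bigcup_mkord => x [k _ [_ /=]]; rewrite scale1r => xr.
  rewrite (_ : x = (a k + x) - a k); last by rewrite addrAC subrr add0r.
  apply: le_trans (ler_normB _ _) _; apply: lerD => //.
  rewrite /a normrN normrZ; apply: mulr_ile1 => //.
    by rewrite ger0_norm// invf_le1// ler1n.
  apply: norm_le_coord => // i; rewrite mxE; case: (_ && _).
    by rewrite normr1.
  by rewrite normr0.
have Nm N : (N%:R%:E * lebesgue_rV n H <= (((r + 1) *+ 2) ^+ n)%:E)%E.
  rewrite -lebesgue_rV_cube; last by lra.
  rewrite (_ : (_ * _)%E = lebesgue_rV n (\big[setU/set0]_(k < N) F k)).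
    apply: le_measure; rewrite ?inE//.
      by apply: bigsetU_measurable => k _.
    have := @measurable_cube R n 0 (r + 1); under eq_set do rewrite subr0.
    by apply; lra.
  rewrite measure_bigsetU//.
  rewrite (eq_bigr (fun=> lebesgue_rV n H)) => [|k _]; last exact (FH k).
  rewrite big_const_ord.
  elim: N => [|N IH]; first by rewrite mul0e.
  rewrite /= -IH -[in LHS]addn1 addnC natrD EFinD ge0_muleDl// mul1e//.
have Hf : lebesgue_rV n H \is a fin_num.
  by rewrite ge0_fin_numE// (le_lt_trans HV)// ltry.
have := Nm; rewrite -(fineK Hf); set m := fine _ => {}Nm.
have m0 : 0 <= m by exact: fine_ge0.
apply/eqP; rewrite eqe; apply: contraT => mn0.
have {}m0 : 0 < m by rewrite lt_def mn0.
have := Nm (Num.truncn (((r + 1) *+ 2) ^+ n / m)).+1.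
rewrite -EFinM lee_fin leNgt -ltr_pdivrMr//.
by rewrite real_truncnS_gt// num_real.
Qed.

End dotp.

(** * Moments of a body of volume one *)

Lemma convex_setP (R : realType) n (A : set 'rV[R]_n) :
  convex_set (A : set (convex_lmodType 'rV[R]_n)) <->
  forall x y t, A x -> A y -> 0 <= t -> t <= 1 -> A (t *: x + (1 - t) *: y).
Proof.
split=> [cA x y t Ax Ay t0 t1|cA x y t].
  by have := cA x y (Itv01 t0 t1); rewrite !inE; apply.
rewrite !inE => Ax Ay.
exact: cA.
Qed.

Lemma sub_conv_hull (R : realType) n (V : set 'rV[R]_n) : V `<=` conv_hull V.
Proof. exact: sub_smallest. Qed.

Lemma conv_hull_min (R : realType) n (V A : set 'rV[R]_n) :
  (forall x y t, A x -> A y -> 0 <= t -> t <= 1 -> A (t *: x + (1 - t) *: y)) ->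
  V `<=` A -> conv_hull V `<=` A.
Proof. by move=> /convex_setP cA VA x; apply. Qed.

Lemma conv_hull_dotp_le (R : realType) n (V : set 'rV[R]_n) y a :
  (forall w, V w -> dotp w y <= a) ->
  forall x, conv_hull V x -> dotp x y <= a.
Proof.
move=> Va; apply: (@conv_hull_min _ _ _ [set x | dotp x y <= a]) => // x z t /=.
move=> xa za t0 t1.
rewrite dotpDl !dotpZl.
have -> : a = t * a + (1 - t) * a by ring.
by apply: lerD; apply: ler_wpM2l => //; rewrite subr_ge0.
Qed.

Section unit_volume.
Context {R : realType} {n : nat} (K : set 'rV[R]_n).
Local Notation mu := (@lebesgue_rV R n).
Hypotheses (mK : measurable K) (K1 : mu K = 1%E).

Lemma integrable_bounded (f : 'rV[R]_n -> R) M : measurable_fun setT f ->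
  (forall x, K x -> `|f x| <= M) -> mu.-integrable K (EFin \o f).
Proof.
move=> mf fM; apply: measurable_bounded_integrable => //.
- by rewrite [X in (X < _)%E]K1 ltry.
- exact: measurable_funS mf.
- exists M; split; first exact: num_real.
  by move=> r Mr x Kx; apply: (le_trans (fM _ Kx)); exact: ltW.
Qed.

Lemma integrable_indic_unit S : measurable S -> mu.-integrable K (EFin \o \1_S).
Proof.
move=> mS; apply: (@integrable_bounded _ 1); first exact: measurable_indic.
by move=> x _; rewrite indicE normr_nat lern1 leq_b1.
Qed.

Lemma Rintegral_indic S : measurable S ->
  \int[mu]_(x in K) \1_S x = fine (mu (S `&` K)).
Proof. by move=> mS; rewrite /Rintegral integral_indic. Qed.

Lemma Rintegral_cst_unit r : \int[mu]_(x in K) r = r.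
Proof.
by rewrite Rintegral_cst// [X in _ * X](_ : _ = fine 1%E) ?mulr1// -K1.
Qed.

(** A form of Markov's inequality, used to bound moments from below by a cap of [K]. *)
Lemma Rintegral_ge_indic (f : 'rV[R]_n -> R) M S c : measurable_fun setT f ->
  (forall x, K x -> `|f x| <= M) -> measurable S -> S `<=` K ->
  (forall x, K x -> 0 <= f x) -> (forall x, S x -> c <= f x) ->
  c * fine (mu S) <= \int[mu]_(x in K) f x.
Proof.
move=> mf fM mS SK f0 fc.
rewrite -{1}(setIidl SK) -Rintegral_indic// -RintegralZl//; last first.
  exact: integrable_indic_unit.
apply: le_Rintegral => //.
- apply: (@integrable_bounded (fun x => c * \1_S x) `|c|) => [|x _].
    by apply: measurable_funM.
  by rewrite normrM ler_piMr// indicE normr_nat lern1 leq_b1.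
- exact: integrable_bounded mf fM.
- move=> x Kx; rewrite indicE; case: (boolP (x \in S)) => [|_].
    by rewrite inE mulr1 => /fc.
  by rewrite mulr0 f0.
Qed.

(** Split [K] into two cubes of side [2 * r], where [f] is at most 1, and the rest, where it is at
    most [q]. Two centres serve because [|<x,y>|] peaks at a vertex and at its opposite. *)
Lemma Rintegral_le_cubes (f : 'rV[R]_n -> R) M v w r q :
  measurable_fun setT f -> (forall x, K x -> `|f x| <= M) -> 0 <= r ->
  (forall x, K x -> f x <= 1) -> 0 <= q ->
  (forall x, K x -> r < `|x - v| -> r < `|x - w| -> f x <= q) ->
  \int[mu]_(x in K) f x <= 2 * (2 * r) ^+ n + q.
Proof.
move=> mf fM r0 f1 q0 fq.
pose B v := [set x : 'rV[R]_n | `|x - v| <= r].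
have mB u : measurable (B u) by exact: measurable_cube.
have iB u := integrable_indic_unit _ (mB u).
have Bv u : \int[mu]_(x in K) \1_(B u) x <= (2 * r) ^+ n.
  rewrite Rintegral_indic// mulr_natl -[leRHS]/(fine ((r *+ 2) ^+ n)%:E).
  rewrite -(@lebesgue_rV_cubeC _ _ u)//.
  have BK : (mu (B u `&` K) <= mu (B u))%E.
    by apply: le_measure; rewrite ?inE//; exact: measurableI.
  have Bf : mu (B u) \is a fin_num by rewrite [mu _]lebesgue_rV_cubeC.
  apply: fine_le => //.
  by rewrite ge0_fin_numE// (le_lt_trans BK)// -ge0_fin_numE.
have mI u : measurable_fun setT (\1_(B u) : 'rV[R]_n -> R).
  exact: measurable_indic.
have I1 u x : 0 <= (\1_(B u) x : R) <= 1 by rewrite indicE ler0n lern1 leq_b1.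
have iBB : mu.-integrable K (EFin \o (fun x => \1_(B v) x + \1_(B w) x)).
  apply: (@integrable_bounded _ 2); first exact: measurable_funD.
  move=> x _; have := I1 v x; have := I1 w x.
  by move=> ? ?; rewrite ger0_norm; lra.
have iq : mu.-integrable K (EFin \o (fun=> q)).
  by apply: (@integrable_bounded _ `|q|) => // x _.
apply: (@le_trans _ _ (\int[mu]_(x in K) ((\1_(B v) x + \1_(B w) x) + q))).
  apply: le_Rintegral => //; first exact: integrable_bounded mf fM.
    apply: (@integrable_bounded _ (2 + q)).
      by apply: measurable_funD => //; exact: measurable_funD.
    move=> x _; have := I1 v x; have := I1 w x.
    by move=> ? ?; rewrite ger0_norm; lra.
  move=> x Kx; rewrite !indicE.
  case: (boolP (x \in B v)) => [_|/negP].
    by rewrite (le_trans (f1 _ Kx))// -addrA lerDl addr_ge0.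
  case: (boolP (x \in B w)) => [_ _|/negP].
    by rewrite (le_trans (f1 _ Kx))// add0r lerDl.
  rewrite !inE /B/= => /negP; rewrite -ltNge => xw /negP; rewrite -ltNge => xv.
  by rewrite !add0r fq.
rewrite RintegralD// RintegralD//.
rewrite [X in _ + X]Rintegral_cst_unit lerD2r mulr_natl mulr2n.
by apply: lerD; exact: Bv.
Qed.

End unit_volume.

Definition moment {R : realType} {n : nat} (K : set 'rV[R]_n) (p : R)
    (y : 'rV[R]_n) : R :=
  \int[@lebesgue_rV R n]_(x in K) (`|dotp x y| `^ p).

Lemma momentE (R : realType) n (K : set 'rV[R]_n) p y :
  moment K p y = \int[@lebesgue_rV R n]_(x in K) (`|dotp x y| `^ p).
Proof. by []. Qed.

Lemma powR_invK (R : realType) (p x : R) : 0 < p -> 0 <= x ->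
  (x `^ p^-1) `^ p = x.
Proof. by move=> p0 x0; rewrite -powRrM mulVf ?gt_eqF// powRr1. Qed.

Section moment.
Context {R : realType} {n : nat} (K : set 'rV[R]_n).
Local Notation mu := (@lebesgue_rV R n).
Hypotheses (compactK : compact K) (K1 : mu K = 1%E).
Hypotheses (convexK : forall x y t, K x -> K y -> 0 <= t -> t <= 1 ->
  K (t *: x + (1 - t) *: y)).
Hypothesis (symK : symmetric_set K).

Let closedK : closed K.
Proof. by apply: compact_closed => //; exact: norm_hausdorff. Qed.

Let mK : measurable K.
Proof. exact: closed_measurable_rV. Qed.

Lemma compact_norm_bound : exists2 B, 0 <= B & forall x, K x -> `|x| <= B.
Proof.
have [M [_ KM]] := compact_bounded compactK.
exists (`|M| + 1) => [|x Kx]; first by rewrite addr_ge0.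
by apply: KM => //; rewrite ltr_pwDr// ler_norm.
Qed.

Lemma measurable_moment_fun p y :
  measurable_fun setT (fun x : 'rV[R]_n => `|dotp x y| `^ p).
Proof.
have h := (measurableT_comp (@measurable_powR R p)
  (measurableT_comp (@normr_measurable _ setT) (measurable_dotp y))).
exact h.
Qed.

Lemma moment_fun_bound p y : 0 <= p ->
  exists M, forall x, K x -> `|(`|dotp x y| `^ p)| <= M.
Proof.
move=> p0; have [B B0 KB] := compact_norm_bound.
exists ((n%:R * (B * `|y|)) `^ p) => x Kx.
rewrite ger0_norm ?powR_ge0//; apply: ge0_ler_powR => //.
  by rewrite nnegrE !mulr_ge0.
apply: le_trans (dotp_norm_le _ _) _.
by apply: ler_wpM2l => //; apply: ler_wpM2r => //; exact: KB.
Qed.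

Lemma integrable_moment_fun p y : 0 <= p ->
  mu.-integrable K (EFin \o (fun x => `|dotp x y| `^ p)).
Proof.
move=> p0; have [M fM] := moment_fun_bound _ y p0.
exact: (integrable_bounded _ mK K1 _ _ (measurable_moment_fun p y) fM).
Qed.

Lemma moment_ge0 p y : 0 <= moment K p y.
Proof. by apply: Rintegral_ge0 => x _; exact: powR_ge0. Qed.

Lemma sym_dotp_norm_le y a :
  (forall x, K x -> dotp x y <= a) -> forall x, K x -> `|dotp x y| <= a.
Proof.
move=> Ka x Kx; rewrite ler_norml lerNl -dotpNl; apply/andP; split; apply: Ka => //.
exact: symK.
Qed.

Lemma moment_le1 p y : 0 <= p -> (forall x, K x -> dotp x y <= 1) ->
  moment K p y <= 1.
Proof.
move=> p0 /sym_dotp_norm_le y1.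
rewrite -[leRHS](Rintegral_cst_unit _ mK K1); apply: le_Rintegral => //.
- exact: integrable_moment_fun.
- by apply: (integrable_bounded _ mK K1 _ 1) => // x _; rewrite normr1.
- move=> x Kx; have -> : 1 = 1 `^ p :> R by rewrite powR1.
  apply: ge0_ler_powR => //.
    by rewrite nnegrE.
  exact: y1.
Qed.

Lemma momentZ p y a : 0 <= p -> 0 <= a ->
  moment K p (a *: y) = a `^ p * moment K p y.
Proof.
move=> p0 a0; rewrite /moment -RintegralZl//; last exact: integrable_moment_fun.
by apply: eq_Rintegral => x _; rewrite dotpZr normrM powRM// ger0_norm.
Qed.

Lemma moment_cap p y v s : 0 <= p -> 0 < s -> s <= 2^-1 -> K v ->
  (forall x, K x -> dotp x y <= dotp v y) ->
  ((1 - 2 * s) * dotp v y) `^ p * s ^+ n <= moment K p y.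
Proof.
move=> p0 s0 s1 Kv vmax.
(* [x |-> a + s^-1 *: x] inverts [x |-> s *: x + (1 - s) *: v], so [S] is the shrunken copy of [K]
   at [v]. *)
pose a := - (s^-1 * (1 - s)) *: v.
pose S := (fun x => a + s^-1 *: x) @^-1` K.
have mS : measurable S.
  by rewrite -[X in measurable X]setTI; exact: measurable_affine_rV.
have SE x : x = s *: (a + s^-1 *: x) + (1 - s) *: v.
  rewrite scalerDr !scalerA mulrN mulfV ?lt0r_neq0// mulrA mulfV ?lt0r_neq0//.
  by rewrite scale1r mul1r scaleNr addrAC addNr add0r.
have SK : S `<=` K.
  by move=> x Sx; rewrite (SE x); apply: convexK => //; lra.
have muS : fine (mu S) = s ^+ n.
  by rewrite lebesgue_rV_preimage_affine ?invr_gt0// K1 mule1 invrK.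
have [M fM] := moment_fun_bound _ y p0.
rewrite -muS /moment.
apply: (Rintegral_ge_indic _ mK K1 _ _ _ _ (measurable_moment_fun p y) fM mS SK) => //.
move=> x Sx.
have h0 : 0 <= dotp v y.
  have := vmax _ (symK _ Kv); rewrite dotpNl; lra.
apply: ge0_ler_powR => //.
- by rewrite nnegrE mulr_ge0//; lra.
- apply: le_trans (ler_norm _).
  (* By symmetry [dotp _ y] is at least [- dotp v y] on [K]; hence the factor [(1 - s) - s]. *)
  rewrite (SE x) dotpDl !dotpZl.
  have := vmax _ (symK _ Sx); rewrite dotpNl => /ler_wpM2l => /(_ _ (ltW s0)).
  by nra.
Qed.

End moment.

Global Opaque moment.

(** * The polar of the centroid body *)

Lemma linear_dotp (R : realType) n (L : 'rV[R]_n -> R) :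
  (forall x y, L (x + y) = L x + L y) -> (forall a x, L (a *: x) = a * L x) ->
  exists z, forall y, L y = dotp z y.
Proof.
move=> LD LZ; exists (\row_i L (delta_mx ord0 i)) => y.
have L0 : L 0 = 0 by rewrite -(scale0r 0) LZ mul0r.
rewrite {1}(row_sum_delta y) (big_morph L LD L0).
by apply: eq_bigr => i _; rewrite LZ mxE mulrC.
Qed.

(** Young's inequality for [(a / A) ^ (p - 1)] and [b / B], multiplied by [A ^ (p - 1) * B]. When
    [A] and [B] are the [L_p] norms of the functions [a] and [b], integrating the right-hand side
    gives [A ^ (p - 1) * B], which is Hölder's inequality. *)
Lemma young_scaled (R : realType) (p A B a b : R) :
  1 < p -> 0 < A -> 0 < B -> 0 <= a -> 0 <= b ->
  a `^ (p - 1) * b <=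
  A `^ (p - 1) * B * (1 - p^-1) / A `^ p * a `^ p +
  A `^ (p - 1) * B * p^-1 / B `^ p * b `^ p.
Proof.
move=> p1 A0 B0 a0 b0; have p0 : 0 < p by lra.
have Ap : 0 < A `^ (p - 1) by apply: powR_gt0.
have App : 0 < A `^ p by apply: powR_gt0.
have Bpp : 0 < B `^ p by apply: powR_gt0.
have q0 : 0 < p / (p - 1) by rewrite divr_gt0//; lra.
have a0' : 0 <= a / A by rewrite divr_ge0// ltW.
have b0' : 0 <= b / B by rewrite divr_ge0// ltW.
have pq : (p / (p - 1))^-1 + p^-1 = 1.
  by field; rewrite gt_eqF//= subr_eq0 gt_eqF.
have := conjugate_powR (powR_ge0 (a / A) (p - 1)) b0' q0 p0 pq.
have -> : ((a / A) `^ (p - 1)) `^ (p / (p - 1)) = (a / A) `^ p.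
  by rewrite -powRrM; congr powR; field; rewrite subr_eq0 gt_eqF.
have -> : (p / (p - 1))^-1 = 1 - p^-1 by rewrite -[in RHS]pq addrK.
have powRV c r : 0 < c -> (c^-1) `^ r = (c `^ r)^-1.
  by move=> c0; rewrite -(powR_inv1 (ltW c0)) -powRrM mulN1r powRN.
rewrite !powRM ?invr_ge0 ?(ltW A0) ?(ltW B0)// !powRV//.
move: (a `^ (p - 1)) (A `^ (p - 1)) (A `^ p) (B `^ p) (a `^ p) (b `^ p) Ap App Bpp.
move=> u Au App Bpp s t Au0 App0 Bpp0 h.
rewrite (_ : u * b = Au * B * (u / Au * (b / B))); last first.
  by field; rewrite !gt_eqF.
have AB : 0 <= Au * B by rewrite mulr_ge0 ?ltW.
apply: le_trans (ler_wpM2l AB h) _.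
rewrite le_eqVlt; apply/orP; left; apply/eqP; field.
by rewrite !gt_eqF.
Qed.

Section dual.
Context {R : realType} {n : nat} (K : set 'rV[R]_n).
Local Notation mu := (@lebesgue_rV R n).
Hypotheses (compactK : compact K) (K1 : mu K = 1%E).
Hypotheses (convexK : forall x y t, K x -> K y -> 0 <= t -> t <= 1 ->
  K (t *: x + (1 - t) *: y)).
Hypothesis (symK : symmetric_set K).
Context (rho : R).
Hypotheses (rho0 : 0 < rho) (rhoK : forall x, `|x| <= rho -> K x).

Let mK : measurable K.
Proof.
apply: closed_measurable_rV.
by apply: compact_closed => //; exact: norm_hausdorff.
Qed.

Lemma dotp_max y : exists2 v, K v & forall x, K x -> dotp x y <= dotp v y.
Proof.
have [||v] := @compact_EVT_max _ _ (fun x => dotp x y) K _ compactK.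
- by exists 0; apply: rhoK; rewrite normr0 ltW.
- by apply: continuous_subspaceT; exact: dotp_continuous.
rewrite inE => Kv vmax; exists v => // x Kx; apply: vmax; exact: mem_set.
Qed.

Lemma dotp_max_gt0 y v : y != 0 ->
  (forall x, K x -> dotp x y <= dotp v y) -> 0 < dotp v y.
Proof.
move=> y0 vmax; have ny : 0 < `|y| by rewrite normr_gt0.
have Kc : K ((rho / `|y|) *: y).
  by apply: rhoK; rewrite normrZ normrM normfV normr_id gtr0_norm// divfK ?gt_eqF.
apply: lt_le_trans (vmax _ Kc).
rewrite dotpZl mulr_gt0 ?divr_gt0// lt_def dotp_ge0 andbT.
by apply: contra_neq y0; exact: dotp_eq0.
Qed.

Lemma moment_gt0 p y : 0 < p -> y != 0 -> 0 < moment K p y.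
Proof.
move=> p0 y0; have [v Kv vmax] := dotp_max y.
have h0 := dotp_max_gt0 _ _ y0 vmax.
(* Any [s] strictly between 0 and 1/2 gives a positive bound; 1/4 is one choice. *)
apply: lt_le_trans (moment_cap K compactK K1 convexK symK p y v 4^-1 _ _ _ Kv vmax).
- by rewrite mulr_gt0 ?exprn_gt0 ?powR_gt0 ?mulr_gt0//; lra.
- exact: ltW.
- by lra.
- by lra.
Qed.

Lemma moment_root p y : 0 < p -> y != 0 ->
  exists A, [/\ 0 < A, moment K p y `^ p^-1 = A & moment K p y = A `^ p].
Proof.
move=> p0 y0; exists (moment K p y `^ p^-1); split => //.
  by apply: powR_gt0; exact: moment_gt0.
by apply/esym/powR_invK => //; exact: moment_ge0.
Qed.

(** The factor before [dotp x y] is [|<x,y0>|^(p-1)] with the sign of [<x,y0>], the derivative of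
    [|.|^p / p]. Writing the exponent as [p - 1 - 1] lets [mulr_powRB1] absorb the product. *)
Lemma integrable_dual p y0 y : 1 < p -> mu.-integrable K
  (EFin \o (fun x => dotp x y0 * `|dotp x y0| `^ (p - 1 - 1) * dotp x y)).
Proof.
move=> p1; have p1' : 0 <= p - 1 by lra.
have [M gM] := moment_fun_bound K compactK (p - 1) y0 p1'.
have [M' yM] := moment_fun_bound K compactK 1 y ler01.
apply: (integrable_bounded _ mK K1 _ (M * M')).
  apply: measurable_funM; last exact: measurable_dotp.
  apply: measurable_funM; first exact: measurable_dotp.
  exact: measurable_moment_fun.
move=> x Kx; rewrite normrM; apply: ler_pM => //.
  apply: le_trans (gM _ Kx); rewrite [leRHS]ger0_norm ?powR_ge0//.
  rewrite normrM [X in _ * X]ger0_norm ?powR_ge0// mulr_powRB1//; lra.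
by have := yM _ Kx; rewrite powRr1// normr_id.
Qed.

(* The gradient at [y0] of the norm [moment^(1/p)] supports it, by Hölder's
   inequality. This spares an appeal to Hahn-Banach. *)
Lemma moment_dual p y0 : 1 < p -> y0 != 0 ->
  exists2 z, dotp z y0 = moment K p y0 `^ p^-1 &
    forall y, dotp z y <= moment K p y `^ p^-1.
Proof.
move=> p1 y00; have p0 : 0 < p by lra.
have [A [A0 -> AE]] := moment_root p y0 p0 y00.
have Ap : 0 < A `^ (p - 1) by apply: powR_gt0.
pose g x := dotp x y0 * `|dotp x y0| `^ (p - 1 - 1).
have gE x : `|g x| = `|dotp x y0| `^ (p - 1).
  rewrite normrM [X in _ * X]ger0_norm ?powR_ge0// mulr_powRB1//; lra.
have gy0 x : g x * dotp x y0 = `|dotp x y0| `^ p.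
  have aa : dotp x y0 * dotp x y0 = `|dotp x y0| * `|dotp x y0|.
    by rewrite -normrM ger0_norm// -expr2 sqr_ge0.
  by rewrite /g mulrAC aa -mulrA mulr_powRB1 ?mulr_powRB1//; lra.
have ig y : mu.-integrable K (EFin \o (fun x => g x * dotp x y)).
  exact: integrable_dual.
(* The divisor normalizes the gradient so that [L y0 = A ^ p / A ^ (p - 1) = A]. *)
pose L y := \int[mu]_(x in K) (g x * dotp x y) / A `^ (p - 1).
have [z zL] : exists z, forall y, L y = dotp z y.
  apply: linear_dotp => [x y|a y]; rewrite /L.
    rewrite -mulrDl -RintegralD//; congr (_ / _).
    by apply: eq_Rintegral => w _; rewrite dotpDr mulrDr.
  rewrite mulrA -RintegralZl//; congr (_ / _).
  by apply: eq_Rintegral => w _; rewrite dotpZr; ring.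
exists z => [|y]; rewrite -zL /L.
  have -> : \int[mu]_(x in K) (g x * dotp x y0) = A `^ p.
    by rewrite -AE momentE; apply: eq_Rintegral => x _; exact: gy0.
  by rewrite -(mulr_powRB1 (ltW A0) p0) mulfK// gt_eqF.
rewrite ler_pdivrMr//.
(* Young's inequality is scaled by the norm [B] of [y], which must be positive. *)
have [->|yn0] := eqVneq y 0.
  rewrite (_ : Rintegral _ _ _ = 0) ?mulr_ge0 ?powR_ge0//.
  rewrite -(Rintegral_cst_unit _ mK K1 0).
  by apply: eq_Rintegral => x _; rewrite dotp0r mulr0.
have [B [B0 -> BE]] := moment_root p y p0 yn0.
have Bp : 0 < B `^ p by apply: powR_gt0.
have App : 0 < A `^ p by apply: powR_gt0.
pose c1 := A `^ (p - 1) * B * (1 - p^-1) / A `^ p.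
pose c2 := A `^ (p - 1) * B * p^-1 / B `^ p.
have i1 := integrable_moment_fun K compactK K1 p y0 (ltW p0).
have i2 := integrable_moment_fun K compactK K1 p y (ltW p0).
have i1' : mu.-integrable K (EFin \o (fun x => c1 * `|dotp x y0| `^ p)).
  by have := integrableZl mK c1 i1.
have i2' : mu.-integrable K (EFin \o (fun x => c2 * `|dotp x y| `^ p)).
  by have := integrableZl mK c2 i2.
apply: (@le_trans _ _
   (\int[mu]_(x in K) (c1 * `|dotp x y0| `^ p + c2 * `|dotp x y| `^ p))).
  apply: le_Rintegral => //.
    by have := integrableD mK i1' i2'.
  move=> x Kx; apply: le_trans (ler_norm _) _; rewrite normrM gE.
  exact: young_scaled.
rewrite RintegralD// !RintegralZl// -!momentE AE BE /c1 /c2.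
rewrite le_eqVlt; apply/orP; left; apply/eqP.
move: (A `^ (p - 1)) (A `^ p) (B `^ p) Ap App Bp => *.
by field; rewrite !gt_eqF.
Qed.

End dual.

(** * Existence of the centroid body and description of its polar *)

Section body.
Context {R : realType} {n : nat} (K : set 'rV[R]_n).
Local Notation mu := (@lebesgue_rV R n).
Hypotheses (compactK : compact K) (K1 : mu K = 1%E).
Hypotheses (convexK : forall x y t, K x -> K y -> 0 <= t -> t <= 1 ->
  K (t *: x + (1 - t) *: y)).
Hypothesis (symK : symmetric_set K).
Context (rho : R).
Hypotheses (rho0 : 0 < rho) (rhoK : forall x, `|x| <= rho -> K x).
Context (p : R).
Hypothesis (p1 : 1 < p).

Let N y := moment K p y `^ p^-1.
(** The candidate centroid body: the intersection of the half-spaces prescribed by [N]. Closedness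
    and convexity come for free; that [N] is really its support function is [moment_dual]. *)
Let Z : set 'rV[R]_n := [set z | forall y, dotp z y <= N y].

Let p0 : 0 < p. Proof. by apply: lt_trans p1. Qed.

Let closedZ : closed Z.
Proof.
rewrite (_ : Z = \bigcap_(y in [set: 'rV[R]_n]) [set z | dotp z y <= N y]).
  apply: closed_bigI => y _.
  apply: (@preimage_closed _ _ (fun z => dotp z y) [set a | a <= N y]).
    move=> z _; exact: dotp_continuous.
  exact: closed_le.
by apply/seteqP; split => z /= zZ y; [move=> _|]; exact: zZ.
Qed.

(** Testing with plus and minus the basis vectors bounds each coordinate; the sum is a bound common
    to all of them. *)
Let boundedZ : bounded_set Z.
Proof.
pose e i : 'rV[R]_n := delta_mx ord0 i.
exists (\sum_i (N (e i) + N (- e i))); split; first exact: num_real.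
move=> r Mr z Zz; apply: le_trans (ltW Mr).
have N0 y : 0 <= N y by exact: powR_ge0.
apply: norm_le_coord => [|i].
  by apply: sumr_ge0 => i _; apply: addr_ge0; exact: N0.
have s0 : 0 <= \sum_(j < n | j != i) (N (e j) + N (- e j)).
  by apply: sumr_ge0 => j _; apply: addr_ge0; exact: N0.
have z1 := Zz (e i); have z2 := Zz (- e i).
have n1 := N0 (e i); have n2 := N0 (- e i).
rewrite [leRHS](bigD1 i)//=.
move: s0 z1 z2 n1 n2; rewrite dotpNr dotp_delta.
move: (N (e i)) (N (- e i)) (\sum_(_ < _ | _) _) => a b c.
by rewrite ler_norml; lra.
Qed.

Let convexZ : convex_set (Z : set (convex_lmodType 'rV[R]_n)).
Proof.
apply/convex_setP => x y t Zx Zy t0 t1 w; rewrite dotpDl !dotpZl.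
have -> : N w = t * N w + (1 - t) * N w by ring.
by apply: lerD; apply: ler_wpM2l; rewrite ?subr_ge0.
Qed.

Let interiorZ : interior Z !=set0.
Proof.
(* The [p]-th root of the bound of [moment_cap] at [s = 1/4] is [k * dotp v y], so that [Z] contains
   [k K] and with it a ball. *)
pose k := 2^-1 * (4^-1 ^+ n) `^ p^-1 : R.
have k0 : 0 < k by rewrite mulr_gt0// powR_gt0 ?exprn_gt0.
have kK x : K x -> Z (k *: x).
  move=> Kx y; have [v Kv vmax] := dotp_max K compactK rho rho0 rhoK y.
  have h0 : 0 <= dotp v y by have := vmax _ (symK _ Kv); rewrite dotpNl; lra.
  have := moment_cap K compactK K1 convexK symK p y v 4^-1 (ltW p0).
  move=> /(_ ltac:(lra) ltac:(lra) Kv vmax).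
  rewrite (_ : 1 - 2 * 4^-1 = 2^-1); last by field.
  rewrite dotpZl => cap.
  apply: (@le_trans _ _ (k * dotp v y)).
    by apply: ler_wpM2l; [exact: ltW|exact: vmax].
  have q0 : 0 <= p^-1 by rewrite invr_ge0 ltW.
  have := ge0_ler_powR q0 _ _ cap; rewrite !nnegrE moment_ge0.
  rewrite mulr_ge0 ?powR_ge0 ?exprn_ge0// => /(_ erefl erefl); apply: le_trans.
  rewrite powRM ?powR_ge0 ?exprn_ge0// -powRrM divff ?gt_eqF// powRr1.
    by rewrite /k mulrAC.
  by rewrite mulr_ge0.
exists 0; apply/nbhs_ballP; exists (k * rho); first by rewrite /= mulr_gt0.
move=> x; rewrite mx_norm_ball /ball_ /= sub0r normrN => xk.
rewrite (_ : x = k *: (k^-1 *: x)); last by rewrite scalerA divff ?gt_eqF// scale1r.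
apply/kK/rhoK; rewrite normrZ ger0_norm ?invr_ge0 ?ltW//.
by rewrite ltr_pdivrMl.
Qed.

Lemma unit_sphere_neq0 (y : 'rV[R]_n) : unit_sphere y -> y != 0.
Proof.
rewrite /unit_sphere /=; apply: contraPneq => ->; rewrite dotp0l sqrtr0.
by move=> /esym/eqP; rewrite oner_eq0.
Qed.

(** [N] bounds the support function of [Z] by construction, and the vector from [moment_dual] lies
    in [Z] and attains the bound. *)
Lemma Lp_centroid_body_exists : exists C, is_Lp_centroid_body p K C.
Proof.
exists Z; split.
  by split => //; exact: bounded_closed_compact.
move=> y /unit_sphere_neq0 y0.
have [z zy zN] := moment_dual K compactK K1 convexK symK rho rho0 rhoK p y p1 y0.
apply/eqP; rewrite eq_le; apply/andP; split.
  apply: ge_sup; first by exists (dotp y z), z.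
  by move=> _ [x Zx <-]; rewrite dotpC; exact: Zx.
apply: ub_le_sup; last by exists z => //; rewrite dotpC.
by exists (N y) => _ [x Zx <-]; rewrite dotpC; exact: Zx.
Qed.

(** By homogeneity the support function on the unit sphere determines the polar, so whichever set
    [xget] selects gives the same answer. *)
Lemma polar_Lp_centroid_body :
  polar (Lp_centroid_body p K) = [set y | moment K p y <= 1].
Proof.
have [|C CK] := @xgetPex _ set0 (is_Lp_centroid_body p K).
  exact: Lp_centroid_body_exists.
rewrite /Lp_centroid_body; set D := xget _ _ in C CK *.
have [compactD _ intD] := C.
have D0 : D !=set0 by case: intD => x /interior_subset Dx; exists x.
have p0' := ltW p0.
apply/seteqP; suff polarP y : y != 0 -> polar D y <-> moment K p y <= 1.
  split => y /=; have [->|/polarP[yD Dy]] := eqVneq y 0; [|exact: yD| |exact: Dy].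
    by rewrite -(scale0r 0) momentZ// powR0 ?mul0r// gt_eqF.
  by move=> _ x _; rewrite dotp0r.
move=> y0; pose l := Num.sqrt (dotp y y).
have dy : 0 < dotp y y.
  by rewrite lt_def dotp_ge0 andbT; apply: contra_neq y0; exact: dotp_eq0.
have l0 : 0 < l by rewrite sqrtr_gt0.
pose u := l^-1 *: y.
have yE : y = l *: u by rewrite scalerA divff ?gt_eqF// scale1r.
have uS : unit_sphere u.
  rewrite /unit_sphere /= /u dotpZl dotpZr -(sqr_sqrtr (ltW dy)) -/l.
  by rewrite expr2 mulKf ?gt_eqF// mulVf ?gt_eqF// sqrtr1.
have := CK u uS; rewrite -momentE => supE.
have supD : has_ubound [set dotp u x | x in D].
  have [B B0 DB] := compact_norm_bound D compactD.
  exists (n%:R * (`|u| * B)) => _ [x Dx <-].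
  apply: le_trans (ler_norm _) _; apply: le_trans (dotp_norm_le _ _) _.
  by do 2 apply: ler_wpM2l => //; exact: DB.
(* Homogeneity moves the condition to the unit vector [u], where the support function of [D] is
   known. *)
have mE : (moment K p y <= 1) = (moment K p u `^ p^-1 <= l^-1).
  rewrite yE momentZ ?(ltW l0)// -ler_pdivlMl ?powR_gt0// mulr1.
  have mu0 := moment_ge0 K p u.
  have -> : (l `^ p)^-1 = l^-1 `^ p.
    by rewrite -(powR_inv1 (ltW l0)) -powRrM mulN1r powRN.
  apply/idP/idP => h.
    have := @ge0_ler_powR _ p^-1 _ _ _ _ _ h; rewrite !nnegrE powR_ge0 mu0.
    rewrite invr_ge0 p0' => /(_ erefl erefl erefl).
    by rewrite -powRrM divff ?gt_eqF// powRr1// invr_ge0 ltW.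
  have := @ge0_ler_powR _ p _ _ _ _ _ h; rewrite !nnegrE powR_ge0.
  by rewrite invr_ge0 (ltW l0) powR_invK//; apply.
rewrite mE -supE; split => [yD|sl x Dx].
  apply: ge_sup; first by case: D0 => x Dx; exists (dotp u x), x.
  move=> _ [x Dx <-]; rewrite dotpZl -ler_pdivlMl ?invr_gt0// invrK mulfV ?gt_eqF//.
  by rewrite dotpC; exact: yD.
have : dotp u x <= l^-1.
  by apply: le_trans sl; apply: ub_le_sup => //; exists x.
by rewrite dotpZl -ler_pdivlMl ?invr_gt0// invrK mulfV ?gt_eqF// dotpC.
Qed.

End body.

(** * Polytopes *)

Lemma measurable_halfspace (R : realType) n (u : 'rV[R]_n) (a : R) :
  measurable [set y | dotp u y <= a].
Proof.
have := measurable_dotp u measurableT `]-oo, a]%classic.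
rewrite setTI => /(_ (measurable_itv _)).
by congr measurable; apply/seteqP; split => y /=; rewrite in_itv/= dotpC.
Qed.

Section polytope.
Context {R : realType} {n : nat} (V : set 'rV[R]_n).
Local Notation K := (conv_hull V).
Local Notation mu := (@lebesgue_rV R n).
Hypothesis (finV : finite_set V).
Hypotheses (compactK : compact K) (K1 : mu K = 1%E).
Hypotheses (convexK : forall x y t, K x -> K y -> 0 <= t -> t <= 1 ->
  K (t *: x + (1 - t) *: y)).
Hypothesis (symK : symmetric_set K).
Context (rho : R).
Hypotheses (rho0 : 0 < rho) (rhoK : forall x, `|x| <= rho -> K x).

Let mK : measurable K.
Proof.
apply: closed_measurable_rV.
by apply: compact_closed => //; exact: norm_hausdorff.
Qed.

Lemma measurable_polar : measurable (polar K).
Proof. by apply: closed_measurable_rV; exact: polar_closed. Qed.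

Lemma polar_norm_le y : polar K y -> `|y| <= rho^-1.
Proof.
have r0 : 0 <= rho^-1 by rewrite invr_ge0 ltW.
move=> yK; apply: norm_le_coord => // i.
have en : `|delta_mx ord0 i : 'rV[R]_n| <= 1.
  apply: norm_le_coord => // j; rewrite mxE; case: (_ && _).
    by rewrite normr1.
  by rewrite normr0.
have Ke : K (rho *: delta_mx ord0 i).
  by apply: rhoK; rewrite normrZ gtr0_norm// ler_piMr// ltW.
have := yK _ Ke; have := yK _ (symK _ Ke).
rewrite dotpNl dotpZl dotpC dotp_delta -!mulrN -!ler_pdivlMl// mulr1.
by rewrite ler_norml lerNl => -> ->.
Qed.

Lemma polar_volume_fin : mu (polar K) \is a fin_num.
Proof.
have r0 : 0 <= rho^-1 by rewrite invr_ge0 ltW.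
rewrite ge0_fin_numE//.
apply: (@le_lt_trans _ _ (mu [set y | `|y - 0| <= rho^-1])).
  apply: le_measure; rewrite ?inE; [exact: measurable_polar|exact: measurable_cube|].
  by move=> y /polar_norm_le /=; rewrite subr0.
by rewrite [X in (X < _)%E]lebesgue_rV_cubeC// ltry.
Qed.

(* The condition [0 <= dotp v y] makes [v] a maximizer: for a negative value of
   [dotp v y] the relative gap would not even imply [dotp w y <= dotp v y]. *)
Definition gap_cone (d : R) : set 'rV[R]_n :=
  \bigcup_(v in V) ([set y | 0 <= dotp v y] `&`
    \bigcap_(w in V `\ v) [set y | dotp w y <= (1 - d) * dotp v y]).

Lemma measurable_gap_cone d : measurable (gap_cone d).
Proof.
apply: fin_bigcup_measurable => // v Vv; apply: measurableI.
  have := measurable_halfspace R n (- v) 0.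
  by under eq_set do rewrite dotpNl oppr_le0.
apply: fin_bigcap_measurable => [|w Vw]; first exact: finite_setD.
have := measurable_halfspace R n (w - (1 - d) *: v) 0.
by under eq_set do rewrite dotpBl dotpZl subr_le0.
Qed.

Lemma gap_coneZ d a y : 0 < a -> gap_cone d y -> gap_cone d (a *: y).
Proof.
move=> a0 [v Vv [/= v0 vgap]]; exists v => //; split => /=.
  by rewrite dotpZr mulr_ge0// ltW.
by move=> w Vw /=; rewrite !dotpZr mulrCA ler_pM2l//; exact: vgap.
Qed.

(** Away from the cubes of radius [r] about [v] and [-v], the integrand has decayed to [exp(-crp)].
    The constant [c] depends on [d] and the size of [K] only, so the radius can later be chosen as a
    function of [p]. *)
Lemma moment_gap_cone_le d : 0 < d -> exists2 c, 0 < c &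
  forall y p r, polar K y -> gap_cone d y -> 0 <= p -> 0 <= r ->
    moment K p y <= 2 * (2 * r) ^+ n + expR (- (c * r * p)).
Proof.
move=> d0; have [B B0 KB] := compact_norm_bound K compactK.
(* [D] bounds the distance between any two points of [K]; adding 1 keeps it positive. *)
pose D := 2 * B + 1; have D0 : 0 < D by rewrite /D; lra.
pose c := d / D; have c0 : 0 < c by rewrite divr_gt0.
exists c => // y p r yK [v Vv [/= h0 vgap]] p0 r0.
have Kv : K v by exact: sub_conv_hull.
set h := dotp v y in h0 vgap.
have h1 : h <= 1 by exact: yK.
(* The left-hand side is convex in [x], so it is enough to check the points of [V], where the gap
   [d * h] dominates [c * h * D]. *)
have key x : K x -> dotp x y + c * h * `|x - v| <= h.
  apply: (conv_hull_min _ _ V [set x | dotp x y + c * h * `|x - v| <= h]).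
    move=> a z t /= ah zh t0 t1; rewrite dotpDl !dotpZl.
    have -> : t *: a + (1 - t) *: z - v = t *: (a - v) + (1 - t) *: (z - v).
      rewrite !scalerBr addrACA -opprD -scalerDl.
      by rewrite (_ : t + (1 - t) = 1) ?scale1r//; ring.
    have t1' : 0 <= 1 - t by rewrite subr_ge0.
    have nn : `|t *: (a - v) + (1 - t) *: (z - v)| <=
        t * `|a - v| + (1 - t) * `|z - v|.
      by apply: le_trans (ler_normD _ _) _; rewrite !normrZ !ger0_norm.
    have ch : 0 <= c * h by rewrite mulr_ge0// ltW.
    have := ler_wpM2l ch nn.
    have := ler_wpM2l t0 ah; have := ler_wpM2l t1' zh.
    move: `|_ *: _ + _ *: _| `|a - v| `|z - v| => n1 n2 n3; nra.
  move=> w Vw /=; have [->|wv] := pselect (w = v).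
    by rewrite subrr normr0 mulr0 addr0.
  have Kw : K w by exact: sub_conv_hull.
  have gap : dotp w y <= (1 - d) * h by exact: vgap.
  have wvD : `|w - v| <= D.
    apply: le_trans (ler_normB _ _) _; have := KB _ Kw; have := KB _ Kv.
    by rewrite /D; lra.
  have : c * `|w - v| <= d.
    by rewrite /c mulrAC ler_pdivrMr// ler_wpM2l// ltW.
  by move=> /(ler_wpM2l h0) ?; lra.
(* [h * (1 - c * r) <= h * exp(-cr) <= exp(-cr)] since [0 <= h <= 1]; the sign of [1 - c * r] does
   not matter. *)
have bound x : K x -> r < `|x - v| -> dotp x y <= expR (- (c * r)).
  move=> Kx rx; have := key x Kx.
  have e1 := expR_ge1Dx (- (c * r)).
  have e0 : 0 < expR (- (c * r)) by exact: expR_gt0.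
  have crx : c * r <= c * `|x - v| by rewrite ler_pM2l// ltW.
  move: (expR _) e1 e0 => e e1 e0 xh.
  have h1' : 0 <= 1 - h by rewrite subr_ge0.
  have := ler_wpM2l h0 crx; have := ler_wpM2l h0 e1.
  have := mulr_ge0 h1' (ltW e0); lra.
have yK' := sym_dotp_norm_le K symK y 1 yK.
have powle x a : 0 <= a -> `|dotp x y| <= a -> `|dotp x y| `^ p <= a `^ p.
  by move=> a0 xa; apply: ge0_ler_powR; rewrite ?nnegrE.
have [M fM] := moment_fun_bound K compactK p y p0.
rewrite momentE; apply: (Rintegral_le_cubes K mK K1 _ M v (- v)) => //.
- exact: measurable_moment_fun.
- by move=> x Kx; have := powle x 1 ler01 (yK' _ Kx); rewrite powR1.
- move=> x Kx rv rw; rewrite -mulNr expRM; apply: powle; first exact: expR_ge0.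
  rewrite ler_norml lerNl -dotpNl; apply/andP; split; apply: bound => //.
    exact: symK.
  by rewrite -opprD normrN -[v]opprK.
Qed.

End polytope.

Lemma lebesgue_rV_dilate (R : realType) n (a : R) (A : set 'rV[R]_n) :
  0 < a -> measurable A ->
  lebesgue_rV n ((fun y => a^-1 *: y) @^-1` A) = ((a ^+ n)%:E * lebesgue_rV n A)%E.
Proof.
move=> a0 mA; have a0' : 0 < a^-1 by rewrite invr_gt0.
rewrite -[X in (X ^+ n)%:E]invrK -(lebesgue_rV_preimage_affine _ _ _ 0)//.
by congr (lebesgue_rV n _); apply/seteqP; split => y /=; rewrite add0r.
Qed.

Lemma measurable_dilate (R : realType) n (a : R) (A : set 'rV[R]_n) :
  measurable A -> measurable ((fun y => a *: y) @^-1` A).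
Proof.
move=> mA; have := measurable_affine_rV R n 0 a measurableT A mA.
by rewrite setTI; congr measurable; apply/seteqP; split => y /=; rewrite add0r.
Qed.

(** * Two-sided comparison of the volumes of [W_p] and of the polar of [K] *)

Section volumes.
Context {R : realType} {n : nat} (V : set 'rV[R]_n).
Local Notation K := (conv_hull V).
Local Notation mu := (@lebesgue_rV R n).
Hypothesis (finV : finite_set V).
Hypotheses (compactK : compact K) (K1 : mu K = 1%E).
Hypotheses (convexK : forall x y t, K x -> K y -> 0 <= t -> t <= 1 ->
  K (t *: x + (1 - t) *: y)).
Hypothesis (symK : symmetric_set K).
Context (rho : R).
Hypotheses (rho0 : 0 < rho) (rhoK : forall x, `|x| <= rho -> K x).

Let mP : measurable (polar K). Proof. exact: measurable_polar. Qed.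
Let finP : mu (polar K) \is a fin_num.
Proof. exact: (polar_volume_fin V symK rho rho0 rhoK). Qed.

Let K0 : K 0. Proof. by apply: rhoK; rewrite normr0 ltW. Qed.

Lemma finite_dotp_max (S : set 'rV[R]_n) y : finite_set S -> S !=set0 ->
  exists2 v, S v & forall w, S w -> dotp w y <= dotp v y.
Proof.
move=> finS S0.
have [|v] := @compact_EVT_max _ _ (fun x => dotp x y) S S0 (finite_compact finS).
  by apply: continuous_subspaceT; exact: dotp_continuous.
by rewrite inE => Sv vmax; exists v => // x Sx; apply: vmax; exact: mem_set.
Qed.

Let V0 : V !=set0.
Proof.
apply/set0P/eqP => V0; have : conv_hull V `<=` set0.
  by apply: conv_hull_min; rewrite ?V0.
by move=> /(_ _ K0).
Qed.

(** Off the hyperplanes orthogonal to differences of points of [V], the maximizer [v] is unique.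
    With [w0] second best, the relative gap is [1 - <w0,y> / <v,y>]. *)
Lemma gap_cone_generic y :
  (forall v w, V v -> V w -> v <> w -> dotp y (v - w) <> 0) ->
  exists m, gap_cone V m.+1%:R^-1 y.
Proof.
move=> ygen; have [v Vv vmax] := finite_dotp_max V y finV V0.
have Kmax := conv_hull_dotp_le _ _ _ _ _ vmax.
have h0 : 0 <= dotp v y by rewrite -(dotp0l y); exact: Kmax.
(* With a single generating point the gap condition is vacuous, and any [m] will do. *)
have [Vv0|Vvn0] := eqVneq (V `\ v) set0.
  by exists 0%N, v => //; split => //; rewrite Vv0 bigcap_set0.
have [w0 [Vw0 w0v] w0max] := finite_dotp_max (V `\ v) y
  (finite_setD _ finV) ((set0P _).1 Vvn0).
have lt0 : dotp w0 y < dotp v y.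
  rewrite lt_def vmax// andbT; apply/negP => /eqP e.
  have := ygen v w0 Vv Vw0 (fun e => w0v (esym e)).
  by apply; rewrite dotpC dotpBl e subrr.
(* If the maximum were 0, then [-w0], which is in [K] by symmetry, would force [dotp w0 y >= 0],
   against [lt0]. *)
have hp : 0 < dotp v y.
  rewrite lt_def h0 andbT; apply/negP => /eqP e.
  have := Kmax _ (symK _ (sub_conv_hull _ _ _ _ Vw0)).
  by rewrite dotpNl e => ?; move: lt0; rewrite e; lra.
have d0 : 0 < 1 - dotp w0 y / dotp v y by rewrite subr_gt0 ltr_pdivrMr ?mul1r.
near \oo => m.
have md : m.+1%:R^-1 <= 1 - dotp w0 y / dotp v y.
  by near: m; apply: filterS (near_infty_natSinv_lt (PosNum d0)) => k /ltW.
exists m, v => //; split => // w Vw /=.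
apply: le_trans (w0max _ Vw) _.
by rewrite -ler_pdivrMr// lerBrDr addrC -lerBrDr.
Unshelve. all: by end_near.
Qed.

Lemma nondecreasing_gap_cone d e : d <= e -> gap_cone V e `<=` gap_cone V d.
Proof.
move=> de y [v Vv [/= v0 vgap]]; exists v => //; split => // w Vw /=.
by apply: le_trans (vgap w Vw) _; rewrite ler_wpM2r// lerB.
Qed.

(** Continuity of the measure along an increasing union. What the union misses lies in finitely many
    hyperplanes, cut down to a cube containing the polar so that [hyperplane_cube_null] applies. *)
Lemma gap_cone_exhausts :
  fine (mu (polar K `&` gap_cone V m.+1%:R^-1)) @[m --> \oo] -->
  fine (mu (polar K)).
Proof.
pose A m := polar K `&` gap_cone V m.+1%:R^-1.
have mA m : measurable (A m).
  by apply: measurableI => //; exact: measurable_gap_cone.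
have mU : measurable (\bigcup_m A m) by exact: bigcupT_measurable.
suff UE : mu (\bigcup_m A m) = mu (polar K).
  apply: fine_cvg; rewrite fineK// -UE; apply: nondecreasing_cvg_mu => //.
  move=> k l kl; apply/subsetPset => y [Py Gy]; split => //.
  apply: nondecreasing_gap_cone Gy.
  by rewrite lef_pV2 ?posrE// ler_nat.
have UP : \bigcup_m A m `<=` polar K by move=> y [m _ []].
rewrite -[in RHS](setDUK UP) measureU0//; first exact: measurableD.
pose H (q : 'rV[R]_n * 'rV[R]_n) :=
  [set y | dotp y (q.1 - q.2) = 0] `&` [set y | `|y| <= rho^-1].
pose D := (V `*` V) `&` [set q | q.1 <> q.2].
have r0 : 0 <= rho^-1 by rewrite invr_ge0 ltW.
have mH q : measurable (H q).
  apply: measurableI.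
    have := measurable_dotp (q.1 - q.2) measurableT [set 0].
    by rewrite setTI; apply; exact: measurable_set1.
  by have := measurable_cube R n 0 _ r0; under eq_set do rewrite subr0.
have finD : finite_set D by apply: finite_setIl; exact: finite_setX.
apply/eqP; rewrite eq_le measure_ge0 andbT.
apply: (@le_trans _ _ (\sum_(q \in D) mu (H q))).
  apply: content_sub_fsum => //; first exact: measurableD.
  move=> y [Py nU]; apply: contrapT => nD; apply: nU.
  have [v w Vv Vw vw e|m Gy] := gap_cone_generic y.
    apply: nD; exists (v, w) => //; split => //=.
    exact: (polar_norm_le V symK rho).
  by exists m.
rewrite fsbig1// => q [_ /= q12]; apply: hyperplane_cube_null => //.
by rewrite subr_eq0; apply/eqP.
Qed.

Context (p : R).
Local Notation W := [set y | moment K p y <= 1].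

(** As a polar, [W] is closed. *)
Lemma measurable_moment_le1 : 1 < p -> measurable W.
Proof.
move=> p1; rewrite -(polar_Lp_centroid_body K compactK K1 convexK symK rho)//.
by apply: closed_measurable_rV; exact: polar_closed.
Qed.

Lemma polar_sub_moment_le1 : 0 <= p -> polar K `<=` W.
Proof. by move=> p0 y yK; apply: moment_le1. Qed.

Lemma moment_le1_sub_dilate : 4 <= p ->
  W `<=` (fun y => (expR ((4 + n%:R * ln p) / p))^-1 *: y) @^-1` polar K.
Proof.
move=> p4 y /= yW x Kx; have p0 : 0 < p by lra.
have [v Kv vmax] := dotp_max K compactK rho rho0 rhoK y.
set l := expR _; have l0 : 0 < l by exact: expR_gt0.
rewrite dotpZr ler_pdivrMl// mulr1; apply: le_trans (vmax x Kx) _.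
have s0 : 0 < p^-1 by rewrite invr_gt0.
have s4 : p^-1 <= 4^-1 by rewrite lef_pV2 ?posrE.
have s2 : p^-1 <= 2^-1 by lra.
have cap := moment_cap K compactK K1 convexK symK p y v p^-1 (ltW p0) s0 s2 Kv vmax.
have {cap} cap := le_trans cap yW.
rewrite leNgt; apply/negP => lh.
suff : 1 < ((1 - 2 * p^-1) * dotp v y) `^ p * p^-1 ^+ n by lra.
have pn : 0 < p^-1 ^+ n by rewrite exprn_gt0.
rewrite -ltr_pdivrMr// mul1r exprVn invrK.
(* The volume factor [p^-n] of the cap costs the dilation factor [p^(n/p)], the second half of the
   exponent in [l]. *)
have -> : p ^+ n = expR (n%:R * ln p / p) `^ p.
  by rewrite -expRM divfK ?gt_eqF// expRM_natl lnK.
apply: gt0_ltr_powR => //; rewrite ?nnegrE ?expR_ge0//.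
  by rewrite mulr_ge0//; [lra|exact: ltW (lt_trans l0 lh)].
have e2 : 0 < 1 - 2 * p^-1 by lra.
apply: lt_le_trans (_ : _ < (1 - 2 * p^-1) * dotp v y) _; last by [].
apply: (@le_lt_trans _ _ ((1 - 2 * p^-1) * l)); last by rewrite ltr_pM2l.
rewrite /l [(4 + _) / p]mulrDl expRD mulrA -[leLHS]mul1r ler_pM2r ?expR_gt0//.
(* With [s = 1/p <= 1/4], [(1 - 2s)(1 + 4s) = 1 + 2s(1 - 4s) >= 1]; this is the origin of the 4 in
   the exponent. *)
have := expR_ge1Dx (4 / p); have : p^-1 * p^-1 <= 4^-1 * p^-1.
  by rewrite ler_pM2r.
by move: (expR _) => E; nra.
Qed.

Lemma measure_moment_le1_upper : 4 <= p ->
  (mu W <= (expR (n%:R * ((4 + n%:R * ln p) / p)))%:E * mu (polar K))%E.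
Proof.
move=> p4; have p1 : 1 < p by lra.
rewrite expRM_natl -lebesgue_rV_dilate ?expR_gt0//.
apply: le_measure; rewrite ?inE; last exact: moment_le1_sub_dilate.
  exact: measurable_moment_le1.
exact: measurable_dilate.
Qed.

Lemma volume_moment_le1_fin : 4 <= p -> mu W \is a fin_num.
Proof.
move=> p4; rewrite ge0_fin_numE// (le_lt_trans (measure_moment_le1_upper p4))//.
by rewrite -(fineK finP) -EFinM ltry.
Qed.

Lemma volume_moment_le1_upper : 4 <= p ->
  fine (mu W) <= expR (n%:R * ((4 + n%:R * ln p) / p)) * fine (mu (polar K)).
Proof.
move=> p4; rewrite -lee_fin EFinM !fineK//; last exact: volume_moment_le1_fin.
exact: measure_moment_le1_upper.
Qed.

(** With [A] the part of the polar in the cone, [W] contains the disjoint sets [polar K \ A] and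
    [l A], of volumes [|polar K| - |A|] and [l^n |A|]. *)
Lemma volume_moment_le1_lower d l : 4 <= p -> 0 < l ->
  (forall y, polar K y -> gap_cone V d y -> moment K p y <= (l `^ p)^-1) ->
  fine (mu (polar K)) + (l ^+ n - 1) * fine (mu (polar K `&` gap_cone V d)) <=
  fine (mu W).
Proof.
move=> p4 l0 lW; have p1 : 1 < p by lra.
have p0 : 0 <= p by lra.
have mW := measurable_moment_le1 p1.
have fW := volume_moment_le1_fin p4.
have mG := measurable_gap_cone V finV d.
set A := polar K `&` gap_cone V d; have mA : measurable A by exact: measurableI.
have finA : mu A \is a fin_num.
  rewrite ge0_fin_numE// (@le_lt_trans _ _ (mu (polar K)))//.
    by apply: le_measure; rewrite ?inE//; exact: subIsetl.
  by rewrite -ge0_fin_numE.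
pose lA := (fun y => l^-1 *: y) @^-1` A.
have mlA : measurable lA by exact: measurable_dilate.
have lAE : mu lA = ((l ^+ n)%:E * mu A)%E by exact: lebesgue_rV_dilate.
have PA : mu (polar K) = (mu (polar K `\` A) + mu A)%E.
  rewrite (measureDI mu mP mA); congr (_ + mu _)%E.
  by rewrite setIC; apply/setIidl; exact: subIsetl.
have mPA : measurable (polar K `\` A) by exact: measurableD.
have finPA : mu (polar K `\` A) \is a fin_num.
  rewrite ge0_fin_numE// (@le_lt_trans _ _ (mu (polar K)))//.
    by apply: le_measure; rewrite ?inE//; exact: subDsetl.
  by rewrite -ge0_fin_numE.
have dis : (polar K `\` A) `&` lA = set0.
  apply/seteqP; split => // y [[Py nA] [_ Gy]]; apply: nA; split => //.
  have := gap_coneZ V _ _ _ l0 Gy.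
  by rewrite scalerA divff ?gt_eqF// scale1r.
have sub : (polar K `\` A) `|` lA `<=` W.
  move=> y [[Py _]|[Py Gy]]; first exact: polar_sub_moment_le1.
  have yW := lW _ Py Gy.
  have ye : y = l *: (l^-1 *: y) by rewrite scalerA divff ?gt_eqF// scale1r.
  rewrite /= ye momentZ ?(ltW l0)//.
  by rewrite -ler_pdivlMl ?powR_gt0// mulr1.
have muU : mu ((polar K `\` A) `|` lA) =
    (mu (polar K `\` A) + (l ^+ n)%:E * mu A)%E.
  by rewrite -lAE; exact: measureU.
have : (mu ((polar K `\` A) `|` lA) <= mu W)%E.
  by apply: le_measure; rewrite ?inE//; exact: measurableU.
rewrite muU PA.
rewrite -(fineK finPA) -(fineK finA) -(fineK fW) -!EFinM -!EFinD lee_fin.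
by rewrite /=; lra.
Qed.

End volumes.

(** * Asymptotics *)

Lemma near_powR_ge (R : realType) (e C : R) : 0 < e ->
  \forall p \near +oo, C <= p `^ e.
Proof.
move=> e0; near=> p.
have Cp : `|C| `^ e^-1 <= p by near: p; exact: (nbhs_pinfty_ge (num_real _)).
apply: le_trans (ler_norm _) _.
rewrite -[leLHS](@powR_invK R e)//; apply: ge0_ler_powR => //; rewrite ?nnegrE.
- exact: ltW.
- exact: powR_ge0.
- exact: le_trans (powR_ge0 _ _) Cp.
Unshelve. all: by end_near.
Qed.

(** The inequality [ln x < x] at [x = p^e]. *)
Lemma ln_le_powR (R : realType) (e p : R) : 0 < e -> 0 < p ->
  ln p <= e^-1 * p `^ e.
Proof.
move=> e0 p0; rewrite ler_pdivlMl// -ln_powR; apply/ltW/ln_sublinear.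
exact: powR_gt0.
Qed.

Lemma cvg_inv_ln (R : realType) : (ln p)^-1 @[p --> +oo%R] --> (0 : R).
Proof.
apply/cvgrPdist_le => e e0; near=> p.
have pe : expR e^-1 <= p by near: p; exact: (nbhs_pinfty_ge (num_real _)).
have ep : e^-1 <= ln p.
  by rewrite -(expRK e^-1) ler_ln ?posrE ?expR_gt0// (lt_le_trans _ pe)// expR_gt0.
have l0 : 0 < ln p by rewrite (lt_le_trans _ ep)// invr_gt0.
by rewrite sub0r normrN ger0_norm ?invr_ge0 ?(ltW l0)// invf_ple ?posrE.
Unshelve. all: by end_near.
Qed.

Lemma cvg_ln_div (R : realType) : ln p / p @[p --> +oo%R] --> (0 : R).
Proof.
apply/cvgrPdist_le => e e0; near=> p.
have p1 : 1 <= p by near: p; exact: (nbhs_pinfty_ge (num_real _)).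
have p0 : 0 < p by lra.
have pe : 2 / e <= p `^ 2^-1 by near: p; apply: near_powR_ge.
rewrite sub0r normrN ger0_norm ?divr_ge0 ?ln_ge0 ?(ltW p0)// ler_pdivrMr//.
apply: le_trans (ln_le_powR _ 2^-1 _ _ p0) _ => //; rewrite invrK.
have pp : p = p `^ 2^-1 * p `^ 2^-1.
  by rewrite -powRD ?gt_eqF ?implybT// (_ : 2^-1 + 2^-1 = 1) ?powRr1 ?ltW//; field.
rewrite [in leRHS]pp mulrA ler_pM2r ?powR_gt0//.
by rewrite mulrC -ler_pdivrMr.
Unshelve. all: by end_near.
Qed.

Lemma cvg_inv_pinfty (R : realType) : p^-1 @[p --> +oo%R] --> (0 : R).
Proof.
apply/cvgrPdist_le => e e0; near=> p.
have pe : e^-1 <= p by near: p; exact: (nbhs_pinfty_ge (num_real _)).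
have p0 : 0 < p by rewrite (lt_le_trans _ pe)// invr_gt0.
by rewrite sub0r normrN ger0_norm ?invr_ge0 ?(ltW p0)// invf_ple ?posrE.
Unshelve. all: by end_near.
Qed.

Lemma expR_le_inv1B (R : realType) (t : R) : t < 1 -> expR t <= (1 - t)^-1.
Proof.
move=> t1; have e := expR_ge1Dx (- t).
rewrite -[expR t]invrK -expRN lef_pV2 ?posrE ?expR_gt0//; lra.
Qed.

Section asymptotics.
Context {R : realType} {n : nat} (V : set 'rV[R]_n).
Local Notation K := (conv_hull V).
Local Notation mu := (@lebesgue_rV R n).
Hypothesis (finV : finite_set V).
Hypotheses (compactK : compact K) (K1 : mu K = 1%E).
Hypotheses (convexK : forall x y t, K x -> K y -> 0 <= t -> t <= 1 ->
  K (t *: x + (1 - t) *: y)).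
Hypothesis (symK : symmetric_set K).
Context (rho : R).
Hypotheses (rho0 : 0 < rho) (rhoK : forall x, `|x| <= rho -> K x).

Let L := fine (mu (polar K)).
Let W p := fine (mu [set y | moment K p y <= 1]).

Let L0 : 0 <= L. Proof. exact: fine_ge0. Qed.

(** From [exp(t) - 1 <= t / (1 - t)], where [t p] is the exponent in [volume_moment_le1_upper] and
    tends to 0. *)
Lemma deficit_upper e : 0 < e ->
  \forall p \near +oo, p / ln p * (W p - L) <= n%:R ^+ 2 * L + e.
Proof.
move=> e0.
pose t p : R := n%:R * (4 * p^-1 + n%:R * (ln p / p)).
(* The first factor is [p / ln p * t p], expanded so that its limit [n^2] can be read off. *)
pose u p : R := (n%:R ^+ 2 + n%:R * 4 * (ln p)^-1) * (1 - t p)^-1 * L.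
have t_cvg : t p @[p --> +oo%R] --> (0 : R).
  rewrite (_ : 0 = n%:R * (4 * 0 + n%:R * 0)); last by ring.
  apply: cvgMl_tmp; apply: cvgD; apply: cvgMl_tmp; first exact: cvg_inv_pinfty.
  exact: cvg_ln_div.
have u_cvg : u p @[p --> +oo%R] --> n%:R ^+ 2 * L.
  have -> : n%:R ^+ 2 * L = (n%:R ^+ 2 + n%:R * 4 * 0) * (1 - 0)^-1 * L.
    by field.
  apply: cvgMr_tmp; apply: cvgM.
    by apply: cvgD; [exact: cvg_cst|apply: cvgMl_tmp; exact: cvg_inv_ln].
  apply: cvgV; first by rewrite subr0 oner_neq0.
  by apply: cvgB; [exact: cvg_cst|exact: t_cvg].
near=> p.
have p4 : 4 <= p by near: p; exact: (nbhs_pinfty_ge (num_real _)).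
have p0 : 0 < p by lra.
have lp0 : 0 < ln p by rewrite ln_gt0//; lra.
have t1 : t p < 1.
  have : `|0 - t p| < 1 by near: p; move/cvgrPdist_lt : t_cvg; apply.
  by rewrite sub0r normrN ltr_norml => /andP[].
have ue : u p <= n%:R ^+ 2 * L + e.
  have : `|n%:R ^+ 2 * L - u p| <= e by near: p; move/cvgrPdist_le : u_cvg; apply.
  by rewrite ler_norml => /andP[? ?]; lra.
apply: le_trans ue.
have := volume_moment_le1_upper V compactK K1 convexK symK rho rho0 rhoK p p4.
rewrite -/(W p) -/L.
have -> : n%:R * ((4 + n%:R * ln p) / p) = t p by rewrite /t; field; rewrite gt_eqF.
move=> WL; have := expR_le_inv1B _ _ t1 => et.
have {et} WL2 : W p <= (1 - t p)^-1 * L.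
  by apply: le_trans WL _; apply: ler_wpM2r.
have t10 : 0 < 1 - t p by lra.
have pl : 0 < p / ln p by rewrite divr_gt0.
apply: (@le_trans _ _ (p / ln p * ((1 - t p)^-1 * L - L))).
  by rewrite ler_pM2l// lerD2r.
rewrite le_eqVlt; apply/orP; left; apply/eqP.
have -> : (1 - t p)^-1 * L - L = t p * (1 - t p)^-1 * L.
  by move: t10 => /lt0r_neq0 t10; field.
rewrite /u mulrA mulrA; congr (_ * _ * _).
by rewrite /t; field; rewrite !gt_eqF.
Unshelve. all: by end_near.
Qed.

(** Take [r = p^(h-1)] in [moment_gap_cone_le], with [h] small. The cubes have volume of order
    [p^(hn-n)], while [r * p = p^h] still grows, so the exponential term is smaller than any power
    of [p]. *)
Lemma near_moment_gap_cone_le d e : 0 < d -> 0 < e ->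
  \forall p \near +oo, forall y, polar K y -> gap_cone V d y ->
    moment K p y <= p `^ (e - n%:R).
Proof.
move=> d0 e0.
have [c c0 mc] := moment_gap_cone_le V compactK K1 symK d d0.
(* Then [e = h * n + h]: the cubes use up [p^(h*n)], and the spare [p^h] absorbs their constant in
   [E1]. *)
pose h := e / n.+1%:R; have h0 : 0 < h by rewrite divr_gt0.
have h20 : 0 < h / 2 by rewrite divr_gt0.
near=> p => y Py Gy.
have p1 : 1 <= p by near: p; exact: (nbhs_pinfty_ge (num_real _)).
have p0 : 0 < p by lra.
have pn0 : p != 0 by rewrite gt_eqF.
have E1 : 2 ^+ n * 4 <= p `^ h by near: p; exact: near_powR_ge.
have E2 : 2 <= p `^ e by near: p; exact: near_powR_ge.
have E3 : n%:R * (h / 2)^-1 / c <= p `^ (h / 2) by near: p; exact: near_powR_ge.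
apply: le_trans (mc y p (p `^ (h - 1)) Py Gy (ltW p0) (powR_ge0 _ _)) _.
have pw a b : p `^ (a + b) = p `^ a * p `^ b by rewrite powRD// pn0 implybT.
have q0 : 0 < p `^ (- n%:R) by exact: powR_gt0.
have eE : e = h * n%:R + h.
  by rewrite -[X in _ + X]mulr1 -mulrDr natr1 divfK.
have A1 : 2 * (2 * p `^ (h - 1)) ^+ n <= p `^ (e - n%:R) / 2.
  rewrite exprMn -(powR_mulrn n (powR_ge0 _ _)) -powRrM.
  have -> : (h - 1) * n%:R = h * n%:R - n%:R by ring.
  have -> : e - n%:R = h + (h * n%:R - n%:R) by rewrite eE; ring.
  rewrite [in leRHS]pw.
  have := powR_ge0 p (h * n%:R - n%:R).
  move: (p `^ (h * n%:R - n%:R)) (p `^ h) (2 ^+ n) E1 => a b k E1 a0; nra.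
have A2 : expR (- (c * p `^ (h - 1) * p)) <= p `^ (- n%:R).
  have -> : p `^ (- n%:R) = expR (- (n%:R * ln p)).
    by rewrite /powR (negbTE pn0) mulNr.
  rewrite ler_expR lerN2 -mulrA.
  (* One half of [p^h] dominates [ln p], the other absorbs the constants through [E3]. *)
  have -> : p `^ (h - 1) * p = p `^ (h / 2) * p `^ (h / 2).
    by rewrite -pw -[X in _ * X = _](powRr1 (ltW p0)) -pw; congr powR; field.
  have := ln_le_powR _ _ _ h20 p0; have n0 : 0 <= n%:R :> R by [].
  move=> /(ler_wpM2l n0) ll; apply: le_trans ll _.
  by rewrite !mulrA ler_pM2r ?powR_gt0// [leRHS]mulrC -ler_pdivrMr.
have A3 : p `^ (- n%:R) <= p `^ (e - n%:R) / 2.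
  by rewrite pw; move: (p `^ e) (p `^ (- n%:R)) E2 q0 => a b ? ?; nra.
apply: le_trans (lerD A1 (le_trans A2 A3)) _.
by rewrite -splitr.
Unshelve. all: by end_near.
Qed.

Lemma deficit_lower_gap d e : 0 < d -> 0 < e ->
  \forall p \near +oo,
    n%:R * (n%:R - e) * fine (mu (polar K `&` gap_cone V d)) <=
    p / ln p * (W p - L).
Proof.
move=> d0 e0; near=> p.
have p4 : 4 <= p by near: p; exact: (nbhs_pinfty_ge (num_real _)).
have p0 : 0 < p by lra.
have lp0 : 0 < ln p by rewrite ln_gt0//; lra.
(* The largest dilation that the moment bound [p^(e-n)] allows, because moments are homogeneous of
   degree [p]. *)
pose l := p `^ ((n%:R - e) / p).
have l0 : 0 < l by exact: powR_gt0.
have lp : (l `^ p)^-1 = p `^ (e - n%:R).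
  by rewrite /l -powRrM divfK ?gt_eqF// -powRN opprB.
have low : forall y, polar K y -> gap_cone V d y -> moment K p y <= (l `^ p)^-1.
  by rewrite lp; near: p; exact: near_moment_gap_cone_le.
have := volume_moment_le1_lower V finV compactK K1 convexK symK rho rho0 rhoK
  p d l p4 l0 low.
rewrite -/(W p) -/L; set A := fine _ => WA.
have A0 : 0 <= A by exact: fine_ge0.
(* [1 + x <= exp(x)] at [x = n * (n - e) * ln p / p], whatever the sign of [n - e]. *)
have ln1 : n%:R * (n%:R - e) * (ln p / p) <= l ^+ n - 1.
  rewrite lerBrDl -(powR_mulrn n (ltW l0)) /l -powRrM /powR gt_eqF//.
  apply: le_trans (expR_ge1Dx _); rewrite lerD2l le_eqVlt; apply/orP; left.
  by apply/eqP; ring.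
have pl : 0 < p / ln p by rewrite divr_gt0.
apply: (@le_trans _ _ (p / ln p * (n%:R * (n%:R - e) * (ln p / p) * A))).
  rewrite le_eqVlt; apply/orP; left; apply/eqP; field.
  by rewrite !gt_eqF.
rewrite ler_pM2l//.
by have := ler_wpM2r A0 ln1; lra.
Unshelve. all: by end_near.
Qed.

Lemma deficit_lower e : 0 < e ->
  \forall p \near +oo, n%:R ^+ 2 * L - e <= p / ln p * (W p - L).
Proof.
move=> e0.
(* [e1] pays for replacing [A] by [L], [e2] for replacing [n - e2] by [n], each at most [e / 2]; the
   added 1 keeps the denominators positive. The gap is fixed from [e1] before [p] grows. *)
pose e1 := e / 2 / (n%:R ^+ 2 + 1); pose e2 := e / 2 / (n%:R * L + 1).
have nn : 0 <= n%:R :> R by [].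
have nL : 0 <= n%:R * L by rewrite mulr_ge0.
have n2 : 0 <= n%:R ^+ 2 :> R by rewrite exprn_ge0.
have e10 : 0 < e1 by rewrite !divr_gt0//; lra.
have e20 : 0 < e2 by rewrite !divr_gt0//; lra.
have := gap_cone_exhausts V finV symK rho rho0 rhoK.
move=> /cvgrPdist_le => /(_ _ e10) [m _ /(_ m (leqnn m))/=].
rewrite -/L => Am.
have d0 : 0 < m.+1%:R^-1 :> R by rewrite invr_gt0.
apply: filterS (deficit_lower_gap _ _ d0 e20) => p; apply: le_trans.
set A := fine _ in Am *.
have mA : measurable (polar K `&` gap_cone V m.+1%:R^-1).
  by apply: measurableI; [exact: measurable_polar|exact: measurable_gap_cone].
have AL : A <= L.
  have le : (mu (polar K `&` gap_cone V m.+1%:R^-1) <= mu (polar K))%E.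
    apply: le_measure; rewrite ?inE; [exact: mA| |exact: subIsetl].
    exact: measurable_polar.
  have fP := polar_volume_fin V symK rho rho0 rhoK.
  by apply: fine_le => //; rewrite ge0_fin_numE// (le_lt_trans le)// -ge0_fin_numE.
have A0 : 0 <= A by exact: fine_ge0.
move: Am; rewrite ler_norml => /andP[_ Am].
have E1 : n%:R ^+ 2 * e1 <= e / 2.
  rewrite /e1 mulrCA ler_piMr ?divr_ge0//; [lra|].
  by rewrite ler_pdivrMr ?mul1r; lra.
have E2 : n%:R * L * e2 <= e / 2.
  rewrite /e2 mulrCA ler_piMr ?divr_ge0//; [lra|].
  by rewrite ler_pdivrMr ?mul1r; lra.
have F1 : n%:R ^+ 2 * (L - A) <= n%:R ^+ 2 * e1 by exact: ler_wpM2l.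
have F2 : n%:R * e2 * A <= n%:R * e2 * L.
  by apply: ler_wpM2l => //; rewrite mulr_ge0// ltW.
move: F1 F2 E1 E2; rewrite expr2.
move: (n%:R : R) => k; lra.
Qed.

Lemma deficit_cvg :
  p / ln p * (W p - L) @[p --> +oo%R] --> n%:R ^+ 2 * L.
Proof.
apply/cvgrPdist_le => e e0.
apply: filterS2 (deficit_upper _ e0) (deficit_lower _ e0) => p up lo.
by rewrite ler_norml; lra.
Qed.

End asymptotics.

(** If a ball about [x] lies in [K], a small [y] is the midpoint of [x + y] and [-(x - y)], both in
    [K]. *)
Lemma symmetric_convex_body_ball (R : realType) n (K : set 'rV[R]_n) :
  convex_body K -> symmetric_set K ->
  exists2 rho, 0 < rho & forall x, `|x| <= rho -> K x.
Proof.
move=> [_ /convex_setP cK [x /nbhs_ballP[e /= e0 xe]]] symK.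
exists (e / 2) => [|y ye]; first by rewrite divr_gt0.
have {}ye : `|y| < e by apply: le_lt_trans ye _; rewrite ltr_pdivrMr//; lra.
have Kp : K (x + y).
  by apply: xe; rewrite mx_norm_ball /ball_ /= opprD addrA subrr sub0r normrN.
have Km : K (y - x).
  rewrite -opprB; apply/symK/xe.
  by rewrite mx_norm_ball /ball_ /= opprB addrC subrK.
have -> : y = 2^-1 *: (x + y) + (1 - 2^-1) *: (y - x).
  by apply/rowP => i; rewrite !mxE; field.
by apply: cK => //; lra.
Qed.

Theorem theorem1p1 (R : realType) (n : nat) (K : set 'rV[R]_n)
    (K_polytope : polytope K) (K_symmetric : symmetric_set K)
    (K_volume : lebesgue_rV n K = 1%E) :
  p / ln p * (volume (polar (Lp_centroid_body p K)) - volume (polar K))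
    @[p --> +oo%R] --> n%:R ^+ 2 * volume (polar K).
Proof.
have [bodyK [V finV KV]] := K_polytope.
have [compactK /convex_setP cvK _] := bodyK.
have [rho rho0 rhoK] := symmetric_convex_body_ball _ _ _ bodyK K_symmetric.
subst K.
have lim := deficit_cvg V finV compactK K_volume cvK K_symmetric rho rho0 rhoK.
(* For [p > 1] the polar of the centroid body is the sublevel set of the moment, so the two
   functions of [p] eventually agree. *)
apply: cvg_trans lim; apply: near_eq_cvg; near=> p.
have p1 : 1 < p by near: p; exact: (nbhs_pinfty_gt (num_real _)).
by rewrite (polar_Lp_centroid_body _ compactK K_volume cvK K_symmetric rho).
Unshelve. all: by end_near.
Qed.
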